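(* Let $\mathbb P$ be an i.i.d. product measure on $\Omega=\Gamma^{\mathbb Z^d}$ ($\Gamma$ Polish), let $\mathcal R\subset\mathbb Z^d$ be finite with $0\notin\mathcal U=\mathrm{co}\,\mathcal R$ and such that $\mathbb Z^d$ is the smallest additive group containing $\mathcal R$, and let $V:\Omega\times\mathcal R\to\mathbb R$ be measurable such that for each $z\in\mathcal R$ the function $V(\cdot,z)$ depends on only finitely many coordinates of $\omega$ and $V(\cdot,z)\in L^p(\mathbb P)$ for some $p>d$. Then for every $h\in\mathbb R^d$ the point-to-level limit $g_{\rm pl}(h)$ satisfies $$g_{\rm pl}(h)=\inf_{F\in\mathcal K_0}\ \mathbb P\text{-}\operatorname*{ess\,sup}_{\omega}\ \max_{z\in\mathcal R}\{V(\omega,z)+h\cdot z+F(\omega,0,z)\}.$$ A minimizing $F\in\mathcal K_0$ exists for each $h\in\mathbb R^d$.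
   Context: Elements of $\Omega$ are environments $\omega=(\omega_x)_{x\in\mathbb Z^d}$; shifts act by $(\theta_x\omega)_y=\omega_{x+y}$. $\mathrm{co}\,\mathcal R$ is the convex hull in $\mathbb R^d$. A path $x_{0,n}=(x_k)_{k=0}^n\subset\mathbb Z^d$ is admissible if its steps $z_k=x_k-x_{k-1}$ lie in $\mathcal R$. The point-to-level last-passage value with tilt $h\in\mathbb R^d$ is $$G_n(h)=\max_{x_{0,n}:\,x_0=0}\Bigl\{\sum_{k=0}^{n-1}V(\theta_{x_k}\omega,z_{k+1})+h\cdot x_n\Bigr\},$$ the maximum being over admissible $n$-step paths from $0$. Under the stated assumptions it is known (taken for granted) that the nonrandom finite limit $g_{\rm pl}(h)=\lim_{n\to\infty}n^{-1}G_n(h)$ exists $\mathbb P$-a.s. for each $h$. A measurable $B:\Omega\times\mathbb Z^d\times\mathbb Z^d\to\mathbb R$ is a stationary cocycle if for $\mathbb P$-a.e. $\omega$ and all $x,y,z\in\mathbb Z^d$: $B(\omega,x+z,y+z)=B(\theta_z\omega,x,y)$ and $B(\omega,x,y)+B(\omega,y,z)=B(\omega,x,z)$. $\mathcal K$ is the space of stationary cocycles with $\mathbb E|B(x,y)|<\infty$ for all $x,y$; $\mathcal K_0$ is the subspace of $F\in\mathcal K$ with $\mathbb E[F(x,y)]=0$ for all $x,y\in\mathbb Z^d$. *)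

(* Defs.v *)
From HB Require Import structures.
From mathcomp Require Import all_boot all_order all_algebra finmap.
From mathcomp Require Import all_classical all_reals all_analysis ess_sup_inf.

Set Implicit Arguments.
Unset Strict Implicit.
Unset Printing Implicit Defensive.

Import Order.TTheory GRing.Theory Num.Theory.
Import numFieldNormedType.Exports.

Local Open Scope classical_set_scope.
Local Open Scope ring_scope.

Notation site d := 'rV[int]_d.

(* Homeomorphic to a separable complete metric space. *)
Definition polish (R : realType) (T : topologicalType) : Prop :=
  exists (M : metricType R) (f : T -> M) (g : M -> T),
    [/\ cancel f g, cancel g f, continuous f & continuous g] /\
    (forall F : set_system M, ProperFilter F -> cauchy F ->
       exists x : M, F --> x) /\
    (exists2 S : set M, countable S & dense S).

Definition borel (T : ptopologicalType) := g_sigma_algebraType (@open T).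

Definition cylinders (d : nat) (G : ptopologicalType) :
    set (set (site d -> G)) :=
  \bigcup_(x in [set: site d])
    preimage_set_system setT (fun w : site d -> G => w x)
      (@measurable _ (borel G)).

(* G ^ (Z^d) with the product of the Borel sigma-algebras. *)
Definition environment (d : nat) (G : ptopologicalType) :=
  g_sigma_algebraType (@cylinders d G).

Definition env_shift (d : nat) (G : ptopologicalType) (x : site d)
    (w : environment d G) : environment d G :=
  fun y => (w : site d -> G) (x + y).

(* The values on finite-dimensional cylinders determine the product measure. *)
Definition iid_product (R : realType) (d : nat) (G : ptopologicalType)
    (P : probability (environment d G) R) : Prop :=
  exists mu : probability (borel G) R,
    forall (s : {fset site d}) (A : site d -> set (borel G)),
      (forall x, x \in s -> measurable (A x)) ->
      P (\bigcap_(x in [set` s])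
           [set w : environment d G | A x ((w : site d -> G) x)]) =
      (\prod_(x <- s) mu (A x))%E.

Definition embed (R : realType) (d : nat) (x : site d) : 'rV[R]_d :=
  map_mx intr x.

Definition co (R : realType) (d : nat) (steps : {fset site d}) :
    set 'rV[R]_d :=
  smallest (@convex_set R 'rV[R]_d) (@embed R d @` [set` steps]).

Definition additive_span (d : nat) (steps : {fset site d}) : set (site d) :=
  smallest (fun H : set (site d) => zmod_closed [in H]) [set` steps].

Definition dot (R : realType) (d : nat) (h : 'rV[R]_d) (x : site d) : R :=
  \sum_(i < d) h ord0 i * (embed R x) ord0 i.

Definition local_fun (R : realType) (d : nat) (G : ptopologicalType)
    (f : environment d G -> R) : Prop :=
  exists L : {fset site d}, forall w w' : environment d G,
    (forall x, x \in L -> (w : site d -> G) x = (w' : site d -> G) x) ->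
    f w = f w'.

(* Only x 0, ..., x n matter. *)
Definition admissible (d : nat) (steps : {fset site d}) (n : nat)
    (x : nat -> site d) : Prop :=
  x 0%N = 0 /\ forall k, (k < n)%N -> x k.+1 - x k \in steps.

Definition path_value (R : realType) (d : nat) (G : ptopologicalType)
    (V : environment d G -> site d -> R) (h : 'rV[R]_d) (n : nat)
    (w : environment d G) (x : nat -> site d) : R :=
  (\sum_(k < n) V (env_shift (x k) w) (x k.+1 - x k)) + dot h (x n).

(* The supremum is a maximum: see point_to_level_max below. *)
Definition point_to_level (R : realType) (d : nat) (G : ptopologicalType)
    (steps : {fset site d}) (V : environment d G -> site d -> R)
    (h : 'rV[R]_d) (n : nat) (w : environment d G) : R :=
  sup (path_value V h n w @` [set x | admissible steps n x]).

Definition stationary_cocycle (R : realType) (d : nat) (G : ptopologicalType)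
    (P : probability (environment d G) R)
    (B : environment d G -> site d -> site d -> R) : Prop :=
  (* joint measurability, as Z^d is countable and discrete *)
  (forall x y, measurable_fun setT (fun w => B w x y)) /\
  {ae P, forall w, forall x y z,
     B w (x + z) (y + z) = B (env_shift z w) x y /\
     B w x y + B w y z = B w x z}.

Definition cocycles (R : realType) (d : nat) (G : ptopologicalType)
    (P : probability (environment d G) R) :
    set (environment d G -> site d -> site d -> R) :=
  [set B | stationary_cocycle P B /\
    forall x y, ('E_P[fun w => `|B w x y|%R] < +oo)%E].

Definition centered_cocycles (R : realType) (d : nat) (G : ptopologicalType)
    (P : probability (environment d G) R) :
    set (environment d G -> site d -> site d -> R) :=
  [set F | cocycles P F /\ forall x y, ('E_P[fun w => F w x y] = 0)%E].

Definition cocycle_esssup (R : realType) (d : nat) (G : ptopologicalType)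
    (P : probability (environment d G) R) (steps : {fset site d})
    (V : environment d G -> site d -> R) (h : 'rV[R]_d)
    (F : environment d G -> site d -> site d -> R) : \bar R :=
  ess_sup P (fun w =>
    \big[maxe/-oo%E]_(z <- steps) (V w z + dot h z + F w 0 z)%:E).

Lemma point_to_level_max (R : realType) (d : nat) (G : ptopologicalType)
    (steps : {fset site d}) (V : environment d G -> site d -> R)
    (h : 'rV[R]_d) (n : nat) (w : environment d G) :
  steps != fset0 ->
  exists2 x, admissible steps n x &
    path_value V h n w x = point_to_level steps V h n w /\
    forall y, admissible steps n y ->
      path_value V h n w y <= path_value V h n w x.
Proof.
move=> /fset0Pn[z0 z0s].
pose pos (z : n.-tuple steps) (k : nat) : site d :=
  \sum_(i < n | (i < k)%N) val (tnth z i).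
have posS z k (kn : (k < n)%N) :
    pos z k.+1 = pos z k + val (tnth z (Ordinal kn)).
  rewrite /pos (bigD1 (Ordinal kn)) ?ltnS//= addrC.
  by congr (_ + _); apply: eq_bigl => i; rewrite ltnS (ltn_neqAle i k) andbC.
have pos_adm z : admissible steps n (pos z).
  split=> [|k kn]; first by rewrite /pos big1.
  by rewrite posS addrC addKr; exact: valP.
have adm_pos y : admissible steps n y ->
    exists z, path_value V h n w y = path_value V h n w (pos z).
  move=> [y0 ys].
  pose z : n.-tuple steps :=
    [tuple FSetSub (ys (i : 'I_n) (ltn_ord i)) | i < n].
  have posE k : (k <= n)%N -> pos z k = y k.
    elim: k => [|k IH] kn; first by rewrite /pos big1.
    by rewrite posS tnth_mktuple/= IH ?(ltnW kn)// addrC subrK.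
  exists z; rewrite /path_value posE//; congr (_ + _).
  by apply: eq_bigr => i _; rewrite !posE// ltnW.
pose t0 : n.-tuple steps := [tuple FSetSub z0s | i < n].
pose f z := path_value V h n w (pos z).
have [z _ zmax] := @arg_maxP _ _ _ t0 predT f isT.
have ub y : admissible steps n y ->
    path_value V h n w y <= path_value V h n w (pos z).
  by move=> /adm_pos[u ->]; exact: zmax.
exists (pos z) => //; split=> //.
apply/eqP; rewrite eq_le; apply/andP; split.
  apply: ub_le_sup; last by exists (pos z); [exact: pos_adm|].
  by exists (path_value V h n w (pos z)) => _ [y /ub yz <-].
apply: ge_sup.
  by exists (path_value V h n w (pos z)); exists (pos z); first exact: pos_adm.
by move=> _ [y /ub yz <-].
Qed.

(* Main.v *)
(** Existence of a minimizer: the recursion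
    [G_(n+1)(w) = max_z (V(w, z) + h.z + G_n(theta_z w))] shows that the average [U_N]
    of [G_1, ..., G_N], suitably truncated, has increments
    [V(w, z) + h.z + U_N(theta_z w) - U_N(w)] bounded above by
    [G_(N+1)(theta_z w) / (N + 1)] up to a vanishing error, hence asymptotically by
    [gpl h].  The mean-zero coboundaries of [U_N] need not converge, but some forward
    convex combinations of them converge almost surely (Komlos), the limits on the
    steps extend to all lattice sites because the steps generate the lattice, and by
    Fatou the limits have nonnegative means on the steps, so centring them yields a
    cocycle [F] in [K_0] whose essential supremum is at most [gpl h].

    Lower bound: if [V + h.z + F <= c] almost surely, telescoping gives
    [G_n <= n c - min F(0, x)] over the endpoints [x], so it suffices that
    [F(0, x) >= - o(n)] along a subsequence.  The weak law of large numbers along each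
    step direction gives this at the boundedly many coarse points
    [k * sum_z b_z z].  A general endpoint is joined to a coarse one by at
    most [k] steps in each direction, along which each increment of [F] is at most [Y], a
    local function with finite [p]-th moment; since [p > d], truncation and a Chernoff
    bound control the sums of [Y] along all such segments simultaneously. *)

Require Import Defs.
From HB Require Import structures.
From mathcomp Require Import all_boot all_order all_algebra finmap.
From mathcomp Require Import all_classical all_reals all_analysis ess_sup_inf.
From mathcomp Require Import measurable_realfun ring lra zify.

Set Implicit Arguments.
Unset Strict Implicit.
Unset Printing Implicit Defensive.

Import Order.TTheory GRing.Theory Num.Theory.
Import numFieldNormedType.Exports.

Local Open Scope classical_set_scope.
Local Open Scope ring_scope.

(** * Product environments *)

Section environment_structure.
Context (d : nat) (G : ptopologicalType).
Local Notation Omega := (environment d G).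

(** A centred cocycle is only integrable, so it cannot be controlled at all of the order of [n ^ d]
    path endpoints at once. What is uniform is one-sided: its value along a step is at most [Y].
    Endpoints are therefore rounded upwards, to a coarse point ahead of them: an upper bound from
    the endpoint to the coarse point is a lower bound up to the endpoint. The weak law carries no
    rate, so the bad events have vanishing, perhaps not summable, probabilities. This suffices: if
    [c < g], the almost sure limit of [G_n / n] forces the bad events to occur for all large
    indices. All scales are powers of one parameter [j]. Segments have length of order [j ^ B.+1]
    and truncation is at level [j ^ B], so the Chernoff bound is [exp (- j)] against polynomially
    many sites, while a moment of order [q > d] makes exceedances negligible once [B (q - d)] is at
    least [d + 1]. For attainment, increments bounded above with mean zero are bounded in [L^1] and
    no better, so mass may escape in the limit. It escapes towards minus infinity, which can only
    raise the mean of the limit: the harmless direction. *)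

Definition coord (x : site d) (w : Omega) : borel G := (w : site d -> G) x.

Lemma measurable_coord (x : site d) : measurable_fun setT (@coord x).
Proof.
move=> _ B mB; rewrite setTI; apply: sub_sigma_algebra.
by exists x => //; exists B => //; rewrite setTI.
Qed.

Lemma measurable_fun_environment d' (T : measurableType d') (f : T -> Omega) :
  (forall x, measurable_fun setT (coord x \o f)) -> measurable_fun setT f.
Proof.
move=> mf; apply: (@measurability _ _ T (environment d G) setT f (@cylinders d G)) => //.
move=> _ [_ [x _ [B mB <-]] <-]; rewrite !setTI.
by have := mf x measurableT B mB; rewrite setTI.
Qed.

Lemma measurable_env_shift (x : site d) :
  measurable_fun setT (@env_shift d G x).
Proof. by apply: measurable_fun_environment => y; exact: measurable_coord. Qed.

Definition box (s : {fset site d}) (A : site d -> set (borel G)) : set Omega :=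
  \bigcap_(x in [set` s]) [set w : Omega | A x ((w : site d -> G) x)].

(** The generating pi-system on which [iid_product] prescribes the measure. *)
Definition boxes : set (set Omega) :=
  [set E | exists s, exists2 A, (forall x, measurable (A x)) & E = box s A].

Lemma measurable_box (s : {fset site d}) (A : site d -> set (borel G)) :
  (forall x, x \in s -> measurable (A x)) -> measurable (box s A).
Proof.
move=> mA; apply: fin_bigcap_measurable => // x xs; rewrite -[X in measurable X]setTI.
exact: measurable_coord (mA _ xs).
Qed.

Lemma boxes_setI_closed : setI_closed boxes.
Proof.
move=> _ _ [s [A mA ->]] [s' [A' mA' ->]].
exists (s `|` s')%fset, (fun x => (if x \in s then A x else setT) `&`
                       (if x \in s' then A' x else setT)).
  by move=> x; apply: measurableI; case: ifP.
apply/seteqP; split=> w /=.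
  move=> [wA wA'] x _; split; case: ifP => // xs.
    exact: wA.
  exact: wA'.
move=> wA; split=> x /= xs.
  by have /= := wA x; rewrite in_fsetU xs => /(_ isT)[].
by have /= := wA x; rewrite in_fsetU xs orbT => /(_ isT)[].
Qed.

Lemma boxes_generate : @measurable _ Omega = <<s boxes >>.
Proof.
apply/seteqP; split.
  apply: smallest_sub; first exact: smallest_sigma_algebra.
  move=> _ [x _ [B mB <-]]; apply: sub_sigma_algebra.
  exists [fset x]%fset, (fun=> B) => //; rewrite setTI.
  apply/seteqP; split=> w /=; first by move=> wB y /=; rewrite inE => /eqP ->.
  by move=> /(_ x); apply; rewrite /= inE.
apply: smallest_sub; first exact: sigma_algebra_measurable.
by move=> _ [s [A mA ->]]; apply: measurable_box.
Qed.

Section transport.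
Context (R : realType) (P : probability Omega R).

(** Uniqueness of measures on a generating pi-system. The source space is arbitrary, so that one
    lemma serves both the shifts of an environment and the gluing of two environments. *)
Lemma measure_transport d' (T : measurableType d') (Q : {measure set T -> \bar R})
    (f : T -> Omega) :
  measurable_fun setT f ->
  (forall s A, (forall x, measurable (A x)) ->
     Q (f @^-1` box s A) = P (box s A)) ->
  forall E, measurable E -> Q (f @^-1` E) = P E.
Proof.
move=> mf Qbox E mE.
have boxT : boxes setT.
  by exists fset0, (fun=> setT) => //; apply/seteqP; split.
apply/esym.
pose m := measure_function_pushforward__canonical__measure_function_Measure Q mf.
apply: (@measure_unique _ _ _ boxes (fun _ : nat => setT)
  boxes_generate boxes_setI_closed _ _ P m) => //.
- by rewrite bigcup_const//; exists 0%N.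
- by move=> _ [s [A mA ->]]; rewrite /= /pushforward Qbox.
- by move=> _; rewrite (le_lt_trans (probability_le1 _ _)) ?ltry.
Qed.

End transport.

End environment_structure.

(** * Change of variables along a measure-preserving map *)

Section measure_preserving.
Context d d' (T : measurableType d) (T' : measurableType d') (R : realType).
Context (Q : {measure set T -> \bar R}) (P : {measure set T' -> \bar R}).
Context (f : T -> T').
Hypothesis mf : measurable_fun setT f.
Hypothesis QP : forall E, measurable E -> Q (f @^-1` E) = P E.

Lemma ge0_integral_transport (g : T' -> \bar R) : measurable_fun setT g ->
  (forall x, 0 <= g x)%E -> (\int[Q]_x g (f x) = \int[P]_x g x)%E.
Proof.
move=> mg g0.
rewrite -[LHS](@ge0_integral_pushforward _ _ _ _ _ _ mf Q setT)//.
by apply: eq_measure_integral => A mA _; exact: QP.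
Qed.

Lemma integrable_transport (g : T' -> \bar R) :
  P.-integrable setT g -> Q.-integrable setT (g \o f).
Proof.
move=> /integrableP[mg ig]; apply/integrableP; split.
  exact: measurableT_comp.
have mag : measurable_fun setT (abse \o g) by exact: measurableT_comp.
by rewrite (ge0_integral_transport mag)// => x; exact: abse_ge0.
Qed.

Lemma integral_transport (g : T' -> \bar R) : P.-integrable setT g ->
  (\int[Q]_x g (f x) = \int[P]_x g x)%E.
Proof.
move=> ig; have /integrableP[mg _] := ig.
have ig' := integrable_transport ig.
rewrite -[LHS](@integral_pushforward _ _ _ _ _ _ mf Q setT _ mg ig')//.
by apply: eq_measure_integral => A mA _; exact: QP.
Qed.

Lemma ae_transport (A : set T') :
  {ae P, forall x, A x} -> {ae Q, forall x, A (f x)}.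
Proof.
move=> [N [mN N0 AN]]; exists (f @^-1` N); split.
- by rewrite -[X in measurable X]setTI; exact: mf.
- by rewrite QP.
- by move=> x /= nA; exact: AN.
Qed.

End measure_preserving.

Section iid.
Context (R : realType) (d : nat) (G : ptopologicalType).
Context (P : probability (environment d G) R).
Hypothesis P_iid : iid_product P.
Local Notation Omega := (environment d G).

Lemma iid_box : exists mu : probability (borel G) R,
  forall (s : {fset site d}) (A : site d -> set (borel G)),
    (forall x, x \in s -> measurable (A x)) ->
    P (box s A) = (\prod_(x <- s) mu (A x))%E.
Proof. exact: P_iid. Qed.

(** The preimage of a box is the box over the translated sites, and all sites carry the same
    marginal [mu]. *)
Lemma env_shift_preserving (a : site d) (E : set Omega) : measurable E ->
  P (env_shift a @^-1` E) = P E.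
Proof.
have [mu muP] := iid_box; move: E.
apply: measure_transport => [|s A mA]; first exact: measurable_env_shift.
rewrite muP//.
pose s' := [fset (a + x)%R | x in s]%fset.
have shK x : a + x - a = x by rewrite addrC addKr.
have -> : env_shift a @^-1` box s A = box s' (fun y => A (y - a)).
  apply/seteqP; split=> w /=.
    by move=> wA _ /= /imfsetP[x /= xs ->]; rewrite shK; exact: wA.
  move=> wA x /= xs; have /= := wA (a + x); rewrite shK; apply.
  by apply/imfsetP; exists x.
apply: etrans (muP _ _ _) _ => //.
rewrite big_imfset/=; last by move=> x y _ _; exact: addrI.
by apply: eq_bigr => x _; rewrite shK.
Qed.

(** Resampling outside [L] from a second, independent environment. Since this preserves the product
    measure, independence of functions with disjoint supports reduces to Fubini. *)
Definition glue (L : {pred site d}) (u : Omega * Omega) : Omega :=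
  fun x => if x \in L then (u.1 : site d -> G) x else (u.2 : site d -> G) x.

Lemma measurable_glue (L : {pred site d}) : measurable_fun setT (glue L).
Proof.
apply: measurable_fun_environment => x.
rewrite /glue /coord /comp /=; case: (x \in L).
  exact: (measurableT_comp (measurable_coord x) measurable_fst).
exact: (measurableT_comp (measurable_coord x) measurable_snd).
Qed.

(** The preimage of a box is a rectangle: the conditions inside [L] fall on the first environment,
    the others on the second. *)
Lemma glue_preserving (L : {pred site d}) (E : set Omega) : measurable E ->
  (P \x P)%E (glue L @^-1` E) = P E.
Proof.
have [mu muP] := iid_box; move: E.
apply: measure_transport => [|s A mA]; first exact: measurable_glue.
rewrite muP//.
have -> : glue L @^-1` box s A =
    box s (fun x => if x \in L then A x else setT) `*`
    box s (fun x => if x \in L then setT else A x).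
  apply/seteqP; split=> [[w w']|[w w'] []] /=.
    move=> wA; split=> x /= xs; have /= := wA _ xs; rewrite /glue /=;
    by case: ifP.
  move=> wA wA' x xs; have /= := wA _ xs; have /= := wA' _ xs.
  by rewrite /glue/=; case: ifP.
apply: etrans (product_measure1E _ _ _ _) _.
- by apply: measurable_box => x _; case: ifP.
- by apply: measurable_box => x _; case: ifP.
transitivity ((\prod_(x <- s) mu (if x \in L then A x else setT)) *
              (\prod_(x <- s) mu (if x \in L then setT else A x)))%E.
  by congr (_ * _)%E; apply: muP => x _; case: ifP.
rewrite -big_split/=; apply: eq_bigr => x _.
by case: ifP => _; rewrite probability_setT ?mul1e ?mule1.
Qed.

End iid.

Section bounded_functions.
Context d (T : measurableType d) (R : realType).

Lemma bounded_integrable (mu : {measure set T -> \bar R}) (M : R) (f : T -> R) :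
  (mu setT < +oo)%E -> measurable_fun setT f -> (forall x, `|f x| <= M) ->
  mu.-integrable setT (EFin \o f).
Proof.
move=> muT mf fM; apply: measurable_bounded_integrable => //.
exists M; split; first exact: num_real.
by move=> y My x _; exact: le_trans (fM x) (ltW My).
Qed.

Context (P : probability T R).

Lemma prob_lty (A : set T) : measurable A -> (P A < +oo)%E.
Proof. by move=> mA; rewrite (le_lt_trans (probability_le1 _ mA)) ?ltry. Qed.

Lemma prob_bounded_integrable (M : R) (f : T -> R) :
  measurable_fun setT f -> (forall x, `|f x| <= M) ->
  P.-integrable setT (EFin \o f).
Proof. by move=> mf fM; apply: (bounded_integrable _ mf fM); exact: prob_lty. Qed.

Lemma integrable_cstR (c : R) : P.-integrable setT (EFin \o (fun=> c)).
Proof. apply: (@prob_bounded_integrable `|c|) => //; exact: measurable_cst. Qed.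

Lemma integrableDR (f g : T -> R) : P.-integrable setT (EFin \o f) ->
  P.-integrable setT (EFin \o g) ->
  P.-integrable setT (EFin \o (fun x => f x + g x)).
Proof. by move=> fi gi; exact: (integrableD measurableT fi gi). Qed.

Lemma integrableBR (f g : T -> R) : P.-integrable setT (EFin \o f) ->
  P.-integrable setT (EFin \o g) ->
  P.-integrable setT (EFin \o (fun x => f x - g x)).
Proof. by move=> fi gi; exact: (integrableB measurableT fi gi). Qed.

Lemma integrableZR (c : R) (f : T -> R) : P.-integrable setT (EFin \o f) ->
  P.-integrable setT (EFin \o (fun x => c * f x)).
Proof. by move=> fi; exact: (integrableZl measurableT c fi). Qed.

Lemma integrable_normR (f : T -> R) : P.-integrable setT (EFin \o f) ->
  P.-integrable setT (EFin \o (fun x => `|f x|)).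
Proof. by move=> fi; exact: (integrable_abse fi). Qed.

Lemma integrable_sumR (I : Type) (s : seq I) (f : I -> T -> R) :
  (forall i, P.-integrable setT (EFin \o f i)) ->
  P.-integrable setT (EFin \o (fun x => \sum_(i <- s) f i x)).
Proof.
move=> fi; rewrite (_ : _ \o _ = (fun x => \sum_(i <- s) (f i x)%:E)%E).
  by apply: (@integrable_sum _ _ _ _ _ measurableT _ _ xpredT) => i _; exact: fi.
by apply/funext => x /=; rewrite sumEFin.
Qed.

Lemma integrable_measurableR (f : T -> R) : P.-integrable setT (EFin \o f) ->
  measurable_fun setT f.
Proof. by case/integrableP => /measurable_EFinP. Qed.

Lemma Rintegral_cstP (c : R) : \int[P]_x c = c.
Proof. by rewrite Rintegral_cst//= probability_setT mulr1. Qed.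

Lemma Rintegral_sumR (I : Type) (s : seq I) (f : I -> T -> R) :
  (forall i, P.-integrable setT (EFin \o f i)) ->
  \int[P]_x (\sum_(i <- s) f i x) = \sum_(i <- s) \int[P]_x f i x.
Proof.
move=> fi; elim: s => [|i s IH].
  by rewrite big_nil; under eq_Rintegral do rewrite big_nil; rewrite Rintegral_cstP.
rewrite big_cons -IH -RintegralD//; last exact: integrable_sumR.
by apply: eq_Rintegral => x _; rewrite big_cons.
Qed.

Lemma EFin_RintegralP (f : T -> R) : P.-integrable setT (EFin \o f) ->
  ((\int[P]_x f x)%:E = \int[P]_x (f x)%:E)%E.
Proof. by move=> fi; rewrite /Rintegral fineK//; exact: integrable_fin_num. Qed.

Lemma ae_forall_countable (I : countType) (Q : I -> set T) :
  (forall i, {ae P, forall x, Q i x}) -> {ae P, forall x, forall i, Q i x}.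
Proof.
move=> Qae; have Qn (n : nat) :
    {ae P, forall x, forall i : I, @choice.unpickle I n = Some i -> Q i x}.
  case E : (@choice.unpickle I n) => [i|]; last by apply: aeW => x i.
  by apply: filterS (Qae i) => x Qx j [<-].
have := @ae_foralln _ _ _ P _ Qn; apply: filterS => x Qx i.
by apply: (Qx (choice.pickle i)); rewrite choice.pickleK.
Qed.

End bounded_functions.

Section depends_on.
Context (d : nat) (G : ptopologicalType).
Local Notation Omega := (environment d G).

(** Predicates in place of finite sets let the supports of shifted functions and of their sums be
    written by comprehension. *)
Definition depends_on (L : {pred site d}) (T : Type) (f : Omega -> T) :=
  forall w w' : Omega, (forall x, x \in L -> (w : site d -> G) x = (w' : site d -> G) x) ->
    f w = f w'.

Lemma depends_on_shift (L : {pred site d}) (T : Type) (f : Omega -> T) a :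
  depends_on L f -> depends_on [pred x | x - a \in L] (f \o env_shift a).
Proof.
move=> fL w w' ww'; apply: fL => x xL; apply: ww'.
by rewrite inE addrC addKr.
Qed.

Lemma env_shiftD (a b : site d) (w : Omega) :
  env_shift a (env_shift b w) = env_shift (b + a) w.
Proof. by apply/funext => x; rewrite /env_shift addrA. Qed.

Lemma env_shift0 (w : Omega) : env_shift 0 w = w.
Proof. by apply/funext => x; rewrite /env_shift add0r. Qed.

(** Some coordinate of [z *+ j] is at least [j] in absolute value, while the coordinate differences
    within [L] are bounded. Hence functions supported on [L] decouple when shifted [l] multiples of
    [z] apart. *)
Lemma separating_multiple (z : site d) (L : {fset site d}) : z != 0 ->
  exists2 l, (0 < l)%N &
    forall j x y, (l <= j)%N -> x \in L -> y \in L -> x <> y + z *+ j.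
Proof.
move=> z0; have [i zi] : exists i, z ord0 i != 0.
  apply/existsP; apply: contraR z0; rewrite negb_exists => /forallP z0.
  by apply/eqP/rowP => i; rewrite mxE; apply/eqP; have := z0 i; rewrite negbK.
pose m := (\sum_(x <- L) \sum_(y <- L) `|x ord0 i - y ord0 i|)%N.
exists m.+1 => // j x y mj xL yL xyj.
have : (`|x ord0 i - y ord0 i| <= m)%N.
  rewrite /m (big_rem x)//= (big_rem y yL)/= -addnA; exact: leq_addr.
rewrite xyj !mxE addrC addKr => jm.
have : (j <= `|(z *+ j) ord0 i|)%N.
  rewrite mulmxnE -mulr_natr abszM natz absz_nat leq_pmull//.
  by rewrite lt0n absz_eq0.
move=> /leq_trans /(_ jm) /(leq_trans mj); by rewrite ltnn.
Qed.

End depends_on.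

(** * Shift invariance of means, and independence of functions with disjoint supports *)

Section independence.
Context (R : realType) (d : nat) (G : ptopologicalType).
Context (P : probability (environment d G) R).
Hypothesis P_iid : iid_product P.
Local Notation Omega := (environment d G).

Lemma integrable_shift (a : site d) (f : Omega -> R) :
  P.-integrable setT (EFin \o f) ->
  P.-integrable setT (EFin \o (fun w => f (env_shift a w))).
Proof.
move=> fi.
exact: (integrable_transport (measurable_env_shift a)
  (env_shift_preserving P_iid a) fi).
Qed.

Lemma Rintegral_shift (a : site d) (f : Omega -> R) :
  P.-integrable setT (EFin \o f) ->
  \int[P]_w f (env_shift a w) = \int[P]_w f w.
Proof.
move=> fi; congr fine.
exact: (integral_transport (measurable_env_shift a)
  (env_shift_preserving P_iid a) fi).
Qed.

Lemma ae_shift (Q : set Omega) : {ae P, forall w, Q w} ->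
  {ae P, forall w, forall x, Q (env_shift x w)}.
Proof.
move=> Qae; apply: ae_forall_countable => x.
exact: (ae_transport (measurable_env_shift x) (env_shift_preserving P_iid x) Qae).
Qed.

(** At the glued environment [f] sees only the first argument and [g] only the second, so the mean
    of the product is an integral of [f u.1 * g u.2] over independent copies. *)
Lemma independence (L L' : {pred site d}) (M : R) (f g : Omega -> R) :
  (forall x, x \in L -> x \notin L') ->
  depends_on L f -> depends_on L' g ->
  measurable_fun setT f -> measurable_fun setT g ->
  (forall w, `|f w| <= M) -> (forall w, `|g w| <= M) ->
  \int[P]_w (f w * g w) = (\int[P]_w f w) * \int[P]_w g w.
Proof.
move=> LL' fL gL' mf mg fM gM.
have M0 : 0 <= M by exact: le_trans (fM point).
have mfg : measurable_fun setT (fun w => f w * g w) by exact: measurable_funM.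
have fgi : P.-integrable setT (EFin \o (fun w => f w * g w)).
  apply: (@prob_bounded_integrable _ _ _ _ (M * M)) => // w.
  by rewrite normrM ler_pM.
have gi : P.-integrable setT (EFin \o g) by exact: prob_bounded_integrable gM.
have fi : P.-integrable setT (EFin \o f) by exact: prob_bounded_integrable fM.
pose h (u : Omega * Omega) := ((f u.1 * g u.2)%:E).
have hE u : (f (glue L u) * g (glue L u))%:E = h u.
  rewrite /h; congr ((_ * _)%:E).
    by apply: fL => x xL; rewrite /glue xL.
  apply: gL' => x xL'; rewrite /glue; case: ifP => // xL.
  by have := LL' _ xL; rewrite xL'.
have hi : (P \x P)%E.-integrable setT h.
  have := integrable_transport (measurable_glue L)
    (glue_preserving P_iid L) fgi.
  by apply: eq_integrable => // u _; rewrite -hE.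
have e : (\int[P]_w (f w * g w)%:E = \int[(P \x P)%E]_u h u)%E.
  rewrite -(integral_transport (measurable_glue L) (glue_preserving P_iid L) fgi).
  by apply: eq_integral => u _; rewrite -hE.
rewrite /Rintegral e -integral12_prod_meas1//.
rewrite -fineM; [|exact: integrable_fin_num..].
congr fine.
have gfin : (\int[P]_w (g w)%:E \is a fin_num)%E by exact: integrable_fin_num.
rewrite -(fineK gfin) -(integralZr measurableT fi).
apply: eq_integral => w _.
by rewrite (fineK gfin) -(integralZl measurableT gi).
Qed.

End independence.

(** * Weak law of large numbers along a line *)

Section orbit_averages.
Context (R : realType) (d : nat) (G : ptopologicalType).
Context (P : probability (environment d G) R).
Hypothesis P_iid : iid_product P.
Context (z : site d).
Hypothesis z_neq0 : z != 0.
Local Notation Omega := (environment d G).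
Implicit Types f g : Omega -> R.

Definition orbit_sum f (k : nat) (w : Omega) : R :=
  \sum_(j < k) f (env_shift (z *+ j) w).

Lemma measurable_shifted f (a : site d) : measurable_fun setT f ->
  measurable_fun setT (fun w => f (env_shift a w)).
Proof. by move=> mf; exact: (measurableT_comp mf (measurable_env_shift a)). Qed.

Lemma measurable_orbit_sum f k : measurable_fun setT f ->
  measurable_fun setT (orbit_sum f k).
Proof.
by move=> mf; apply: measurable_sum => j; exact: measurable_shifted.
Qed.

Lemma orbit_sum_bound (M : R) f k w : (forall w, `|f w| <= M) ->
  `|orbit_sum f k w| <= M * k%:R.
Proof.
move=> fM; apply: le_trans (ler_norm_sum _ _ _) _.
apply: le_trans (ler_sum _ (fun i _ => fM _)) _.
by rewrite sumr_const card_ord mulr_natr.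
Qed.

Lemma orbit_sumS f k w :
  orbit_sum f k.+1 w = orbit_sum f k w + f (env_shift (z *+ k) w).
Proof. by rewrite /orbit_sum big_ord_recr. Qed.

(** The new term [f_ k] is centred and independent of the sum of the first [k - l] terms, and the
    other [l] terms contribute a bounded amount; so the second moment grows by a bounded amount at
    each step. *)
Lemma orbit_sum_variance (L : {fset site d}) f :
  measurable_fun setT f -> (forall w, `|f w| <= 1) -> depends_on (mem L) f ->
  \int[P]_w f w = 0 ->
  exists2 C : R, 0 <= C & forall k, \int[P]_w (orbit_sum f k w) ^+ 2 <= C * k%:R.
Proof.
move=> mf f1 fL f0.
have [l _ lL] := separating_multiple L z_neq0.
have fi : P.-integrable setT (EFin \o f) by exact: prob_bounded_integrable f1.
have Si k : P.-integrable setT (EFin \o (fun w => (orbit_sum f k w) ^+ 2)).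
  apply: (@prob_bounded_integrable _ _ _ _ ((1 * k%:R) ^+ 2)).
    by apply: measurable_funX; exact: measurable_orbit_sum.
  by move=> w; rewrite normrX lerXn2r ?nnegrE// orbit_sum_bound.
pose f_ k w := f (env_shift (z *+ k) w).
have mf_ k : measurable_fun setT (f_ k) by exact: measurable_shifted.
have f_1 k w : `|f_ k w| <= 1 by exact: f1.
(* The cross term with the last [l] summands costs at most [2 * l], the square of the new term at
   most 1. *)
exists (2 * l%:R + 1) => [|k]; first by rewrite addr_ge0// mulr_ge0.
elim: k => [|k IH].
  rewrite mulr0 /orbit_sum; under eq_Rintegral do rewrite big_ord0 expr0n/=.
  by rewrite Rintegral_cstP.
(* The subtraction is truncated: for [k <= l] this is the empty sum. *)
pose S' := orbit_sum f (k - l).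
have S'f : \int[P]_w (S' w * f_ k w) = 0.
  rewrite (@independence _ _ _ _ P_iid
    [pred x | has (fun j => x - z *+ j \in L) (iota 0 (k - l))]
    [pred x | x - z *+ k \in L] k.+1%:R)//=.
  - by rewrite [X in _ * X](Rintegral_shift P_iid _ fi) f0 mulr0.
  - move=> x; rewrite !inE => /hasP[j]; rewrite mem_iota add0n => /andP[_ jk] xj.
    apply/negP => xk; have := lL (k - j)%N _ _ _ xj xk; apply.
      by lia.
    rewrite mulrnBr; last by rewrite ltnW// (leq_trans jk)// leq_subr.
    by rewrite addrA subrK.
  - move=> w w' ww'; apply: eq_bigr => j _; apply: fL => x xL; apply: ww'.
    rewrite inE; apply/hasP; exists (j : nat).
      by rewrite mem_iota add0n ltn_ord.
    by rewrite addrC addKr.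
  - exact: (@depends_on_shift _ _ (mem L) R f (z *+ k) fL).
  - exact: measurable_orbit_sum.
  - move=> w; apply: le_trans (orbit_sum_bound _ _ f1) _.
    by rewrite mul1r ler_nat (leq_trans (leq_subr _ _)).
  - by move=> w; apply: le_trans (f_1 k w) _; rewrite ler1n.
have S'i : P.-integrable setT (EFin \o (fun w => S' w * f_ k w)).
  apply: (@prob_bounded_integrable _ _ _ _ (1 * (k - l)%:R * 1)).
    by apply: measurable_funM => //; exact: measurable_orbit_sum.
  by move=> w; rewrite normrM ler_pM// orbit_sum_bound.
have SS' w : `|orbit_sum f k w - S' w| <= l%:R.
  have [kl|lk] := leqP k l.
    rewrite /S' (eqP kl) /orbit_sum big_ord0 subr0.
    apply: le_trans (orbit_sum_bound _ _ f1) _.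
    by rewrite mul1r ler_nat.
  rewrite /S' /orbit_sum -!(big_mkord xpredT (fun j => f (env_shift (z *+ j) w))).
  rewrite (big_cat_nat (leq0n _) (leq_subr l k))//= addrAC subrr add0r.
  apply: le_trans (ler_norm_sum _ _ _) _.
  apply: le_trans (ler_sum _ (fun i _ => f1 _)) _.
  by rewrite sumr_const_nat subKn// ltnW.
apply: (@le_trans _ _ (\int[P]_w ((orbit_sum f k w) ^+ 2 +
    (2 * (S' w * f_ k w) + (2 * l%:R + 1))))).
  apply: le_Rintegral => //.
    by apply: integrableDR => //; apply: integrableDR;
      [exact: integrableZR|exact: integrable_cstR].
  move=> w _; rewrite orbit_sumS -/(f_ k w).
  have := SS' w; have := f_1 k w; rewrite !ler_norml => /andP[a1 a2] /andP[b1 b2].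
  have l0 : 0 <= l%:R :> R by [].
  set a := orbit_sum f k w in b1 b2 *; set b := S' w in b1 b2 *.
  set c := f_ k w in a1 a2 *; set m := l%:R in b1 b2 l0 *.
  have h : (a - b) * c <= m by nra.
  nra.
rewrite RintegralD//; last first.
  by apply: integrableDR; [exact: integrableZR|exact: integrable_cstR].
rewrite RintegralD//; [|exact: integrableZR|exact: integrable_cstR].
rewrite RintegralZl// S'f mulr0 add0r Rintegral_cstP -[k.+1%:R]natr1 mulrDr mulr1.
by rewrite lerD2r.
Qed.

(** The weak law in [L^1] form, a property stable under linear combinations and [L^1] limits; this
    is how it passes from boxes to all integrable functions. *)
Definition wlln f := forall eps : R, 0 < eps -> exists K, forall k, (K <= k)%N ->
  \int[P]_w `|orbit_sum f k w - k%:R * \int[P]_w f w| <= eps * k%:R.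

Lemma integrable_orbit_sum f k : P.-integrable setT (EFin \o f) ->
  P.-integrable setT (EFin \o orbit_sum f k).
Proof.
by move=> fi; apply: integrable_sumR => j; exact: integrable_shift.
Qed.

Lemma integrable_orbit_dev f k (c : R) : P.-integrable setT (EFin \o f) ->
  P.-integrable setT (EFin \o (fun w => `|orbit_sum f k w - c|)).
Proof.
move=> fi; apply: integrable_normR; apply: integrableBR.
  exact: integrable_orbit_sum.
exact: integrable_cstR.
Qed.

Lemma wlln_local_centered (L : {fset site d}) f :
  measurable_fun setT f -> (forall w, `|f w| <= 1) -> depends_on (mem L) f ->
  \int[P]_w f w = 0 -> wlln f.
Proof.
move=> mf f1 fL f0 eps eps0.
have fi : P.-integrable setT (EFin \o f) by exact: prob_bounded_integrable f1.
have [C C0 SC] := orbit_sum_variance mf f1 fL f0.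
pose e := eps / 2; have e0 : 0 < e by rewrite divr_gt0.
exists (Num.truncn (C / e ^+ 2)).+1 => k Kk.
have k0 : 0 < k%:R :> R by rewrite ltr0n (leq_trans _ Kk).
have Ck : C <= e ^+ 2 * k%:R.
  rewrite mulrC -ler_pdivrMr ?exprn_gt0// ltW//.
  by apply: lt_le_trans (truncnS_gt _) _; rewrite ler_nat.
rewrite f0 mulr0; under eq_Rintegral do rewrite subr0.
have Si : P.-integrable setT (EFin \o (fun w => (orbit_sum f k w) ^+ 2)).
  apply: (@prob_bounded_integrable _ _ _ _ ((1 * k%:R) ^+ 2)).
    by apply: measurable_funX; exact: measurable_orbit_sum.
  by move=> w; rewrite normrX lerXn2r ?nnegrE// orbit_sum_bound.
(* In place of Cauchy-Schwarz: [|s| <= a + s ^ 2 / a] with [a = e * k]; the choice of the threshold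
   makes both terms at most [e * k]. *)
apply: (@le_trans _ _
    (\int[P]_w (e * k%:R + (e * k%:R)^-1 * (orbit_sum f k w) ^+ 2))).
  apply: le_Rintegral => //.
  - by apply: integrable_normR; exact: integrable_orbit_sum.
  - by apply: integrableDR; [exact: integrable_cstR|exact: integrableZR].
  move=> w _; set s := orbit_sum f k w; set a := e * k%:R.
  have a0 : 0 < a by rewrite mulr_gt0.
  rewrite -(ler_pM2l a0) mulrDr [a * (a^-1 * _)]mulrA mulfV ?gt_eqF// mul1r -[s ^+ 2]real_normK ?num_real//.
  by have := sqr_ge0 (a - `|s|); have := normr_ge0 s; nra.
rewrite RintegralD//; [|exact: integrable_cstR|exact: integrableZR].
rewrite Rintegral_cstP RintegralZl//.
have -> : eps * k%:R = e * k%:R + e * k%:R by rewrite -mulrDl -splitr.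
rewrite lerD2l mulrC ler_pdivrMr ?mulr_gt0//.
apply: le_trans (SC k) _.
by apply: le_trans (ler_wpM2r (ltW k0) Ck) _; rewrite expr2; nra.
Qed.

Lemma orbit_sumD f g k w :
  orbit_sum (fun w => f w + g w) k w = orbit_sum f k w + orbit_sum g k w.
Proof. by rewrite /orbit_sum big_split. Qed.

Lemma orbit_sumZ (c : R) f k w :
  orbit_sum (fun w => c * f w) k w = c * orbit_sum f k w.
Proof. by rewrite /orbit_sum mulr_sumr. Qed.

Lemma orbit_sum_cst (c : R) k w : orbit_sum (fun=> c) k w = k%:R * c.
Proof. by rewrite /orbit_sum sumr_const card_ord mulr_natl. Qed.

Lemma wlln_cst (c : R) : wlln (fun=> c).
Proof.
move=> eps eps0; exists 0%N => k _; rewrite Rintegral_cstP.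
under eq_Rintegral do rewrite orbit_sum_cst subrr normr0.
by rewrite Rintegral_cstP mulr_ge0// ltW.
Qed.

Lemma wllnD f g : P.-integrable setT (EFin \o f) ->
  P.-integrable setT (EFin \o g) -> wlln f -> wlln g ->
  wlln (fun w => f w + g w).
Proof.
move=> fi gi wf wg eps eps0.
have [|K Kf] := wf (eps / 2); first by rewrite divr_gt0.
have [|K' Kg] := wg (eps / 2); first by rewrite divr_gt0.
exists (maxn K K') => k; rewrite geq_max => /andP[/Kf fk /Kg gk].
rewrite [in leRHS](splitr eps) mulrDl; apply: le_trans (lerD fk gk).
rewrite -RintegralD//; [|exact: integrable_orbit_dev..].
apply: le_Rintegral => //.
- by apply: integrable_orbit_dev; exact: integrableDR.
- by apply: integrableDR; exact: integrable_orbit_dev.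
move=> w _; rewrite orbit_sumD RintegralD// mulrDr opprD addrACA.
exact: ler_normD.
Qed.

Lemma wllnZ (c : R) f : P.-integrable setT (EFin \o f) -> wlln f ->
  wlln (fun w => c * f w).
Proof.
move=> fi wf eps eps0.
have c0 : 0 < `|c| + 1 by rewrite ltr_wpDl.
have [|K Kf] := wf (eps / (`|c| + 1)); first by rewrite divr_gt0.
exists K => k /Kf fk; rewrite RintegralZl//.
under eq_Rintegral do rewrite orbit_sumZ mulrCA -mulrBr normrM.
rewrite RintegralZl//; last exact: integrable_orbit_dev.
apply: le_trans (ler_wpM2l (normr_ge0 c) fk) _.
rewrite mulrA ler_wpM2r// mulrCA ger_pMr// ler_pdivrMr// mul1r.
by rewrite lerDl.
Qed.

(** By shift invariance, replacing [f] by [g] changes the mean deviation of a [k]-term sum by at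
    most [2 k] times their [L^1] distance. *)
Lemma wlln_approx f : P.-integrable setT (EFin \o f) ->
  (forall eps : R, 0 < eps -> exists g, [/\ P.-integrable setT (EFin \o g),
    wlln g & \int[P]_w `|f w - g w| <= eps]) -> wlln f.
Proof.
move=> fi app eps eps0.
have [|g [gi wg fg]] := app (eps / 4); first by rewrite divr_gt0.
have [|K Kg] := wg (eps / 2); first by rewrite divr_gt0.
exists K => k /Kg gk.
have fgi : P.-integrable setT (EFin \o (fun w => `|f w - g w|)).
  by apply: integrable_normR; exact: integrableBR.
apply: (@le_trans _ _ (\int[P]_w (`|orbit_sum g k w - k%:R * \int[P]_w g w| +
    (orbit_sum (fun w => `|f w - g w|) k w + k%:R * (eps / 4))))).
  apply: le_Rintegral => //; first exact: integrable_orbit_dev.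
    apply: integrableDR; first exact: integrable_orbit_dev.
    by apply: integrableDR; [exact: integrable_orbit_sum|exact: integrable_cstR].
  move=> w _.
  have e1 : `|orbit_sum f k w - orbit_sum g k w| <= orbit_sum (fun w => `|f w - g w|) k w.
    by rewrite /orbit_sum -sumrB; exact: ler_norm_sum.
  have e2 : `|k%:R * \int[P]_w g w - k%:R * \int[P]_w f w| <= k%:R * (eps / 4).
    rewrite -mulrBr normrM normr_nat ler_wpM2l// distrC -RintegralB//.
    apply: le_trans fg; apply: le_normr_Rintegral => //; exact: integrableBR.
  have -> : orbit_sum f k w - k%:R * \int[P]_w f w =
      (orbit_sum g k w - k%:R * \int[P]_w g w) +
      ((orbit_sum f k w - orbit_sum g k w) +
       (k%:R * \int[P]_w g w - k%:R * \int[P]_w f w)) by ring.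
  apply: le_trans (ler_normD _ _) _; rewrite lerD2l.
  by apply: le_trans (ler_normD _ _) _; exact: lerD.
rewrite RintegralD//; [|exact: integrable_orbit_dev|]; last first.
  by apply: integrableDR; [exact: integrable_orbit_sum|exact: integrable_cstR].
rewrite RintegralD//; [|exact: integrable_orbit_sum|exact: integrable_cstR].
rewrite Rintegral_cstP {1}/orbit_sum Rintegral_sumR; last first.
  by move=> i; exact: (integrable_shift P_iid _ fgi).
have -> : \sum_(j < k) \int[P]_w `|f (env_shift (z *+ j) w) - g (env_shift (z *+ j) w)|
    = k%:R * \int[P]_w `|f w - g w|.
  rewrite (eq_bigr (fun=> \int[P]_w `|f w - g w|)).
    by rewrite sumr_const card_ord mulr_natl.
  by move=> j _; exact: (Rintegral_shift P_iid _ fgi).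
have : k%:R * \int[P]_w `|f w - g w| <= k%:R * (eps / 4) by rewrite ler_wpM2l.
by move: gk; lra.
Qed.

Lemma integrable_indicR (A : set Omega) : measurable A ->
  P.-integrable setT (EFin \o (\1_A : Omega -> R)).
Proof.
move=> mA; apply: (@prob_bounded_integrable _ _ _ _ 1).
  exact: measurable_indic.
by move=> w; rewrite indicE; case: (_ \in _); rewrite ?normr1 ?normr0.
Qed.

Lemma Rintegral_indicP (A : set Omega) : measurable A ->
  \int[P]_w (\1_A w : R) = fine (P A).
Proof. by move=> mA; rewrite /Rintegral integral_indic// setIT. Qed.

Lemma wlln_indic_box (s : {fset site d}) (A : site d -> set (borel G)) :
  (forall x, measurable (A x)) -> wlln (\1_(box s A)).
Proof.
move=> mA; have mB : measurable (box s A) by apply: measurable_box.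
have Bi := integrable_indicR mB.
set c := \int[P]_w (\1_(box s A) w : R).
have c01 : 0 <= c <= 1.
  rewrite /c Rintegral_indicP//; apply/andP; split; first exact: fine_ge0.
  by rewrite -lee_fin fineK ?probability_le1// fin_num_measure.
have e : (\1_(box s A) : Omega -> R) = (fun w => (\1_(box s A) w - c) + c).
  by apply/funext => w; rewrite subrK.
rewrite e; apply: wllnD.
- by apply: integrableBR => //; exact: integrable_cstR.
- exact: integrable_cstR.
- apply: (@wlln_local_centered s).
  + by apply: measurable_funB => //; exact: measurable_indic.
  + move=> w; rewrite indicE ler_norml; case/andP: c01 => c0 c1.
    by case: (_ \in _) => /=; apply/andP; split; lra.
  + move=> w w' ww'; congr (_ - _); rewrite !indicE; congr (_%:R); congr nat_of_bool.
    by apply/idP/idP; rewrite !inE => wB x /= xs; [rewrite -ww'//|rewrite ww'//]; exact: wB.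
  + by rewrite RintegralB// ?Rintegral_cstP ?subrr//; exact: integrable_cstR.
- exact: wlln_cst.
Qed.

(** Events satisfying the weak law form a Dynkin class containing the boxes, which are local.
    Countable disjoint unions are handled by [wlln_approx]. *)
Lemma wlln_indic (A : set Omega) : measurable A -> wlln (\1_A).
Proof.
move=> mA; pose Q := [set A : set Omega | wlln (\1_A)].
apply: (@dynkin_induction _ Omega (@boxes d G) Q) => //.
- exact: boxes_generate.
- exact: boxes_setI_closed.
- have -> : [set: Omega] = box fset0 (fun=> setT) by apply/seteqP; split.
  exact: wlln_indic_box.
- by move=> _ [s [B mB ->]]; exact: wlln_indic_box.
- move=> S mS wS; rewrite /Q /=.
  have -> : (\1_(~` S) : Omega -> R) = (fun w => 1 + (-1) * \1_S w).
    apply/funext => w; rewrite !indicE in_setC; case: (_ \in _) => /=; ring.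
  apply: wllnD; [exact: integrable_cstR| |exact: wlln_cst|].
    by apply: integrableZR; exact: integrable_indicR.
  by apply: wllnZ => //; exact: integrable_indicR.
- move=> F mF tF wF; rewrite /Q /=.
  set U := \bigcup_k F k.
  have mU : measurable U by exact: bigcupT_measurable.
  apply: wlln_approx => [|eps eps0]; first exact: integrable_indicR.
  (* The partial sums of indicators lie below [\1_U], so their [L^1] distance to it is the remainder
     of this series. *)
  have : (\sum_(0 <= i < n) P (F i))%E @[n --> \oo] --> (fine (P U))%:E.
    rewrite fineK ?fin_num_measure//.
    exact: (measure_sigma_additive (mu := P) mF tF).
  move=> /fine_cvgP[_ /cvgrPdist_le /(_ _ eps0)[n _ /(_ n (leqnn _))]] /=.
  move=> Pn; exists (fun w => \sum_(i < n) \1_(F i) w); split.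
  + by apply: integrable_sumR => i; exact: integrable_indicR.
  + elim: {Pn} n => [|n IH].
      have -> : (fun w => \sum_(i < 0) \1_(F i) w) = (fun=> 0) :> (Omega -> R).
        by apply/funext => w; rewrite big_ord0.
      exact: wlln_cst.
    have -> : (fun w => \sum_(i < n.+1) \1_(F i) w) =
        (fun w => \sum_(i < n) \1_(F i) w + \1_(F n) w) :> (Omega -> R).
      by apply/funext => w; rewrite big_ord_recr.
    apply: wllnD => //; last exact: wF.
      by apply: integrable_sumR => i; exact: integrable_indicR.
    exact: integrable_indicR.
  + apply: le_trans Pn.
    have le w : \sum_(i < n) (\1_(F i) w : R) <= \1_U w.
      have [[i Fi]|nF] := pselect (exists i : 'I_n, F i w).
        rewrite (bigD1 i)//= big1 ?addr0 => [|j ji].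
          by rewrite !indicE !mem_set//; exists i.
        rewrite indicE memNset// => Fj.
        move/trivIsetP : tF => /(_ i j I I); rewrite eq_sym => /(_ ji).
        by move=> /seteqP[/(_ w (conj Fi Fj))].
      rewrite big1 ?indicE// => i _; rewrite indicE memNset// => Fi.
      by apply: nF; exists i.
    under eq_Rintegral do rewrite ger0_norm ?subr_ge0 ?le//.
    rewrite RintegralB//; [|exact: integrable_indicR|]; last first.
      by apply: integrable_sumR => i; exact: integrable_indicR.
    rewrite Rintegral_sumR; last by move=> i; exact: integrable_indicR.
    apply: le_trans (ler_norm _).
    rewrite Rintegral_indicP// lerD2l lerN2 big_mkord.
    rewrite (eq_bigr (fun i : 'I_n => (\int[P]_x (\1_(F i) x : R))%:E)).
      by rewrite sumEFin.
    by move=> i _; rewrite Rintegral_indicP// fineK// fin_num_measure.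
- by rewrite -boxes_generate.
Qed.

Import HBSimple.

Lemma wlln_integrable f : P.-integrable setT (EFin \o f) -> wlln f.
Proof.
move=> fi; apply: wlln_approx => // eps eps0.
have [g [gi _ /fine_cvgP[fin]]] := approximation_sfun_integrable measurableT fi.
move=> /cvgrPdist_le /(_ _ eps0) cvg0.
have [n _ /(_ n (leqnn _)) [fn gn]] := filterI fin cvg0.
exists (g n); split => //.
  have -> : (g n : Omega -> R) = (fun w => \sum_(y <- fset_set (range (g n)))
      y * \1_(g n @^-1` [set y]) w).
    by apply/funext => w; rewrite [LHS]fimfunE fsbig_finite.
  elim: (enum_fset _) => [|y s IH].
    have -> : (fun w => \sum_(y <- [::]) y * \1_(g n @^-1` [set y]) w) = (fun=> 0) :> (Omega -> R).
      by apply/funext => w; rewrite big_nil.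
    exact: wlln_cst.
  have mg y' : measurable (g n @^-1` [set y']) by exact: measurable_sfunP.
  have -> : (fun w => \sum_(y <- y :: s) y * \1_(g n @^-1` [set y]) w) =
     (fun w => y * \1_(g n @^-1` [set y]) w + \sum_(y <- s) y * \1_(g n @^-1` [set y]) w).
    by apply/funext => w; rewrite big_cons.
  apply: wllnD => //.
  - by apply: integrableZR; exact: integrable_indicR.
  - by apply: integrable_sumR => y'; apply: integrableZR; exact: integrable_indicR.
  - by apply: wllnZ; [exact: integrable_indicR|exact: wlln_indic].
rewrite sub0r normrN in gn.
exact: le_trans (ler_norm _) gn.
Qed.

End orbit_averages.

(** * Extraction of almost surely convergent convex combinations *)

Section komlos.
Context (R : realType).

Lemma summable_increments_cvg (u : nat -> R) :
  (\sum_(0 <= j <oo) (`|u j.+1 - u j|)%:E < +oo)%E -> cvgn u.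
Proof.
move=> u_oo; set S := (X in (X < _)%E) in u_oo.
have S0 : (0 <= S)%E by apply: nneseries_ge0 => n _ _; rewrite lee_fin.
have nu : cvgn [normed series (telescope u)].
  apply: nondecreasing_is_cvgn.
    apply/nondecreasing_seqP => n /=.
    by rewrite /series/= big_nat_recr//= lerDl.
  exists (fine S) => _ [n _ <-].
  rewrite -lee_fin fineK ?ge0_fin_numE// /series/= -sumEFin.
  by apply: nneseries_lim_ge => j _ _; rewrite lee_fin.
have := normed_cvg nu; rewrite telescopeK => cu.
have -> : u = (fun n => (u n - u 0%N) + u 0%N).
  by apply/funext => n; rewrite subrK.
by apply: is_cvgD => //; exact: is_cvg_cst.
Qed.

Context d (T : measurableType d) (P : probability T R).

(** The total variation of the sequence has mean at most [2 * K], hence is finite almost surely. *)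
Lemma ae_cvg_summable_increments (X : nat -> T -> R) (K : R) :
  (forall j, P.-integrable setT (EFin \o X j)) ->
  (forall j, \int[P]_x `|X j.+1 x - X j x| <= K / 2 ^+ j) ->
  {ae P, forall x, cvgn (X ^~ x)}.
Proof.
move=> Xi XK.
have di j : P.-integrable setT (EFin \o (fun x => `|X j.+1 x - X j x|)).
  by apply: integrable_normR; exact: integrableBR.
pose S x : \bar R := (\sum_(0 <= j <oo) (`|X j.+1 x - X j x|)%:E)%E.
have md j : measurable_fun setT (fun x => (`|X j.+1 x - X j x|)%:E).
  by have /integrableP[] := di j.
have mS : measurable_fun setT S.
  by apply: ge0_emeasurable_sum => // j x _ _; rewrite lee_fin.
have K0 : 0 <= K.
  have := XK 0%N; rewrite expr0 divr1; apply: le_trans.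
  by apply: Rintegral_ge0.
have IS : (\int[P]_x S x <= (2 * K)%:E)%E.
  rewrite integral_nneseries//.
  apply: lime_le.
    by apply: is_cvg_nneseries => j _ _; exact: integral_ge0.
  apply: nearW => n.
  apply: (@le_trans _ _ (\sum_(0 <= j < n) (K / 2 ^+ j)%:E)%E).
    apply: lee_sum => j _; rewrite -EFin_RintegralP//; exact: XK.
  rewrite sumEFin lee_fin.
  have -> : \sum_(0 <= j < n) K / 2 ^+ j = 2 * K - 2 * K / 2 ^+ n.
    elim: n => [|n IH]; first by rewrite big_nil expr0 divr1 subrr.
    rewrite big_nat_recr//= IH exprS; field.
    by rewrite expf_neq0.
  by rewrite gerBl divr_ge0// mulr_ge0.
have Si : P.-integrable setT S.
  apply/integrableP; split => //.
  under eq_integral do rewrite gee0_abs ?nneseries_ge0//.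
  exact: le_lt_trans IS (ltry _).
have := integrable_ae measurableT Si; apply: filterS => x /(_ I) Sx.
apply: summable_increments_cvg; rewrite -ge0_fin_numE//.
by apply: nneseries_ge0 => j _ _; rewrite lee_fin.
Qed.

(* Among forward convex combinations, nearly minimise the strictly convex functional
   [sum_i E exp (- W_i)]: by
   [(exp(-a/2) - exp(-b/2))^2 = exp(-a) + exp(-b) - 2 exp(-(a+b)/2)],
   near-minimisers are close in probability. *)
Lemma komlos (I : finType) (C : nat -> set (I -> T -> R)) (M : I -> R) :
  (forall n m, (n <= m)%N -> C m `<=` C n) -> (forall n, C n !=set0) ->
  (forall n W W', C n W -> C n W' -> C n (fun i x => (W i x + W' i x) / 2)) ->
  (forall W, C 0%N W -> forall i, [/\ measurable_fun setT (W i),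
     forall x, 0 <= W i x & (\int[P]_x (W i x)%:E <= (M i)%:E)%E]) ->
  exists W_ : nat -> I -> T -> R, exists W : I -> T -> R,
    [/\ forall j, C j (W_ j),
        forall i, P.-integrable setT (EFin \o W i),
        forall i, \int[P]_x W i x <= M i &
        {ae P, forall x, forall i, W_ j i x @[j --> \oo] --> W i x}].
Proof.
move=> Cdecr C0 Cmid Cprop.
have CP n W : C n W -> forall i, [/\ measurable_fun setT (W i),
     forall x, 0 <= W i x & (\int[P]_x (W i x)%:E <= (M i)%:E)%E].
  by move=> /(Cdecr 0%N n (leq0n n)); exact: Cprop.
pose X (W : I -> T -> R) i x := expR (- (W i x / 2)).
pose J (W : I -> T -> R) := \sum_i \int[P]_x (X W i x) ^+ 2.
have X01 W i x : 0 <= W i x -> 0 <= X W i x <= 1.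
  by move=> W0; rewrite expR_ge0/= -expR0 ler_expR oppr_le0 divr_ge0.
have mX n W i : C n W -> measurable_fun setT (X W i).
  move=> /CP /(_ i)[mW _ _]; apply: measurableT_comp => //.
  by apply: measurableT_comp => //; exact: measurable_funM.
have X1 n W i x : C n W -> `|X W i x| <= 1.
  move=> /CP /(_ i)[_ W0 _]; have /andP[? ?] := X01 _ _ _ (W0 x).
  by rewrite ger0_norm.
have Xi n W i : C n W -> P.-integrable setT (EFin \o X W i).
  move=> CW; apply: (@prob_bounded_integrable _ _ _ _ 1); first exact: mX CW.
  by move=> x; exact: X1 CW.
have X2i n W W' i : C n W -> C n W' ->
    P.-integrable setT (EFin \o (fun x => X W i x * X W' i x)).
  move=> CW CW'; apply: (@prob_bounded_integrable _ _ _ _ (1 * 1)).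
    by apply: measurable_funM; [exact: mX CW|exact: mX CW'].
  by move=> x; rewrite normrM ler_pM ?(X1 n).
have J0 W : 0 <= J W.
  by apply: sumr_ge0 => i _; apply: Rintegral_ge0 => x _; exact: sqr_ge0.
pose JC n := [set J W | W in C n].
have JC0 n : has_inf (JC n).
  split; first by have [W CW] := C0 n; exists (J W), W.
  by exists 0 => _ [W _ <-].
(* Nondecreasing in [n], as the classes shrink, and bounded by [#|I|]; its supremum [L] is the value
   that near-minimisers approach. *)
pose In n := inf (JC n).
have In_le n m : (n <= m)%N -> In n <= In m.
  move=> nm; apply: lb_le_inf; first by have [] := JC0 m.
  move=> _ [W CW <-]; apply: ge_inf; first by have [] := JC0 n.
  by exists W => //; exact: Cdecr CW.
have J_le n W : C n W -> J W <= #|I|%:R.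
  move=> CW; rewrite -sum1_card natr_sum; apply: ler_sum => i _.
  rewrite -[leRHS](Rintegral_cstP P); apply: le_Rintegral => //.
  - exact: (X2i _ _ _ _ CW CW).
  - exact: integrable_cstR.
  - move=> x _; have [_ W0 _] := CP _ _ CW i.
    by have /andP[? ?] := X01 _ _ _ (W0 x); rewrite exprn_ile1.
have hsI : has_sup (range In).
  split; first by exists (In 0%N), 0%N.
  exists #|I|%:R => _ [n _ <-]; have [W CW] := C0 n.
  apply: le_trans (J_le _ _ CW); apply: ge_inf; first by have [] := JC0 n.
  by exists W.
pose L := sup (range In).
have InL n : In n <= L by apply: ub_le_sup; [case: hsI|exists n].
pose e j : R := (4 ^+ j)^-1.
have e0 j : 0 < e j by rewrite invr_gt0 exprn_gt0.
have ex j : exists W, exists n, [/\ (j <= n)%N, C n W, L - e j < In n & J W < L + e j].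
  have [_ [n _ <-] Ln] := sup_adherent (e0 j) hsI.
  have [_ [W CW <-] JW] := inf_adherent (e0 j) (JC0 (maxn n j)).
  exists W, (maxn n j); split => //; first exact: leq_maxr.
    by apply: lt_le_trans Ln _; apply: In_le; exact: leq_maxl.
  by apply: lt_le_trans JW _; rewrite lerD2r; exact: InL.
have [W_ W_P] := choice ex; have [n_ nP] := choice W_P.
have CWj j : C j (W_ j).
  by have [jn CW _ _] := nP j; exact: Cdecr jn _ CW.
have XX i j : \int[P]_x (X (W_ j.+1) i x - X (W_ j) i x) ^+ 2 <= 4 * e j.
  pose W := W_ j; pose W' := W_ j.+1.
  (* Both near-minimisers and their midpoint [V] lie in [C m], so [J V] is at least [L - e j]. Hence
     [J W + J W' - 2 * J V] is at most [4 * e j], and this is the sum of the squared distances. *)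
  pose m := minn (n_ j) (n_ j.+1).
  have [_ CW LW JW] := nP j; have [_ CW' LW' JW'] := nP j.+1.
  have ejj : e j.+1 <= e j by rewrite lef_pV2 ?posrE ?exprn_gt0// ler_eXn2l// ltr1n.
  have CmW : C m W by apply: Cdecr CW; exact: geq_minl.
  have CmW' : C m W' by apply: Cdecr CW'; exact: geq_minr.
  have Lm : L - e j <= In m.
    rewrite /m /minn; case: ifP => _; first exact: ltW.
    by apply: le_trans (ltW LW'); rewrite lerD2l lerN2.
  pose V i x := (W i x + W' i x) / 2.
  have CV : C m V by exact: Cmid.
  have Jm : In m <= J V by apply: ge_inf; [case: (JC0 m)|exists V].
  have XV k x : X V k x ^+ 2 = X W k x * X W' k x.
    by rewrite expr2 -!expRD; congr expR; rewrite /V; field.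
  have eqk k : \int[P]_x (X W' k x - X W k x) ^+ 2 =
     \int[P]_x (X W' k x ^+ 2) + \int[P]_x (X W k x ^+ 2) - 2 * \int[P]_x (X V k x ^+ 2).
    rewrite -RintegralZl//; last exact: (X2i _ _ _ _ CV CV).
    rewrite -RintegralD//; [|exact: (X2i _ _ _ _ CmW' CmW')|exact: (X2i _ _ _ _ CmW CmW)].
    rewrite -RintegralB//.
    - by apply: eq_Rintegral => x _; rewrite XV; ring.
    - by apply: integrableDR; [exact: (X2i _ _ _ _ CmW' CmW')|exact: (X2i _ _ _ _ CmW CmW)].
    - by apply: integrableZR; exact: (X2i _ _ _ _ CV CV).
  apply: (@le_trans _ _ (\sum_k \int[P]_x (X W' k x - X W k x) ^+ 2)).
    rewrite (bigD1 i)//= lerDl; apply: sumr_ge0 => k _.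
    by apply: Rintegral_ge0 => x _; exact: sqr_ge0.
  rewrite (eq_bigr _ (fun k _ => eqk k)) big_split/= big_split/= sumrN -mulr_sumr.
  by rewrite -!/(J _); move: JW JW' Jm Lm ejj; rewrite -/W -/W'; lra.
have X2d i j : P.-integrable setT (EFin \o (fun x => (X (W_ j.+1) i x - X (W_ j) i x) ^+ 2)).
  apply: (@prob_bounded_integrable _ _ _ _ ((1 + 1) ^+ 2)).
    apply: measurable_funX; apply: measurable_funB; [exact: mX (CWj j.+1)|exact: mX (CWj j)].
  move=> x; rewrite normrX lerXn2r ?nnegrE//.
  apply: le_trans (ler_normB _ _) _.
  by apply: lerD; [exact: X1 (CWj j.+1)|exact: X1 (CWj j)].
have XK i j : \int[P]_x `|X (W_ j.+1) i x - X (W_ j) i x| <= 5 / 2 ^+ j.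
  have t0 : 0 < 2 ^+ j :> R by rewrite exprn_gt0.
  (* Weighting the square by [2 ^+ j] turns the mean square [4 / 4 ^ j] into [4 / 2 ^ j]; the
     remaining term adds 1 to the constant. *)
  apply: (@le_trans _ _ (\int[P]_x ((2 ^+ j)^-1 +
      2 ^+ j * (X (W_ j.+1) i x - X (W_ j) i x) ^+ 2))).
    apply: le_Rintegral => //.
    - by apply: integrable_normR; apply: integrableBR; [exact: Xi (CWj j.+1)|exact: Xi (CWj j)].
    - by apply: integrableDR; [exact: integrable_cstR|exact: integrableZR].
    move=> x _; set a := (X in `|X|).
    rewrite -(ler_pM2l t0) mulrDr mulfV ?gt_eqF// mulrA -expr2 -exprMn.
    set b := 2 ^+ j * a; have -> : 2 ^+ j * `|a| = `|b|.
      by rewrite normrM ger0_norm// ltW.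
    by rewrite -[b ^+ 2]real_normK ?num_real//; have := sqr_ge0 (1 - `|b|); have := normr_ge0 b; nra.
  rewrite RintegralD//; [|exact: integrable_cstR|exact: integrableZR].
  rewrite Rintegral_cstP RintegralZl//.
  have : 2 ^+ j * \int[P]_x (X (W_ j.+1) i x - X (W_ j) i x) ^+ 2 <= 2 ^+ j * (4 * e j).
    by rewrite ler_pM2l.
  have -> : 2 ^+ j * (4 * e j) = 4 / 2 ^+ j.
    have e4 : 4 ^+ j = 2 ^+ j * 2 ^+ j :> R by rewrite -exprMn -natrM.
    by rewrite /e e4; field; rewrite gt_eqF.
  move=> h; apply: le_trans (lerD (lexx _) h) _.
  by rewrite -[X in X + _]mul1r -mulrDl; rewrite ler_pM2r ?invr_gt0//; lra.
have Xcvg i : {ae P, forall x, cvgn (fun j => X (W_ j) i x)}.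
  apply: (@ae_cvg_summable_increments (fun j => X (W_ j) i) 5) => [j|].
    exact: Xi (CWj j).
  exact: XK.
(* The lower limit always exists in the extended reals and Fatou bounds its mean, so it is almost
   surely finite before any convergence of [W_] is known. *)
pose f i x := limn_einf (fun j => (W_ j i x)%:E).
have W0 j i x : (0 <= (W_ j i x)%:E)%E.
  by rewrite lee_fin; have [_ W0 _] := CP _ _ (CWj j) i.
have mW j i : measurable_fun setT (fun x => (W_ j i x)%:E).
  by apply/measurable_EFinP; have [mW _ _] := CP _ _ (CWj j) i.
have mf i : measurable_fun setT (f i).
  apply: (@emeasurable_fun_cvg _ _ _ _ (fun n x => einfs (fun j => (W_ j i x)%:E) n)).
    by move=> n; exact: measurable_fun_einfs.
  by move=> x _; rewrite /f limn_einf_lim; exact: is_cvg_einfs.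
have f0 i x : (0 <= f i x)%E.
  rewrite /f limn_einf_lim; apply: lime_ge; first exact: is_cvg_einfs.
  by apply: nearW => n; apply: le_ereal_inf_tmp => _ [k /= _ <-]; exact: W0.
have fM i : (\int[P]_x f i x <= (M i)%:E)%E.
  apply: le_trans (fatou P measurableT (fun j => mW j i) (fun j x _ => W0 j i x)) _.
  rewrite limn_einf_lim; apply: lime_le; first exact: is_cvg_einfs.
  apply: nearW => n; apply: ge_ereal_inf.
  exists (\int[P]_x (W_ n i x)%:E)%E; first by exists n => //=.
  by have [_ _] := CP _ _ (CWj n) i.
have fi i : P.-integrable setT (f i).
  apply/integrableP; split => //.
  under eq_integral do rewrite gee0_abs//.
  exact: le_lt_trans (fM i) (ltry _).
exists W_, (fun i x => fine (f i x)); split => //.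
- move=> i; apply: le_integrable (fi i) => //.
    by apply/measurable_EFinP; apply: measurableT_comp => //; exact: fine_measurable.
  by move=> x _ /=; have := f0 i x; case: (f i x) => [r| |]//= _; rewrite leey.
- move=> i; rewrite -lee_fin; apply: le_trans (fM i).
  rewrite EFin_RintegralP; last first.
    apply: le_integrable (fi i) => //.
      by apply/measurable_EFinP; apply: measurableT_comp => //; exact: fine_measurable.
    by move=> x _ /=; have := f0 i x; case: (f i x) => [r| |]//= _; rewrite leey.
  apply: ge0_le_integral => //.
  - by move=> x _; rewrite lee_fin fine_ge0.
  - by apply/measurable_EFinP; apply: measurableT_comp => //; exact: fine_measurable.
  - by move=> x _; have := f0 i x; case: (f i x) => [r| |]//=; rewrite leey.
apply: ae_forall_countable => i.
have := integrable_ae measurableT (fi i); apply: filterS2 (Xcvg i) => x cX /(_ Logic.I) fx.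
have WX j : W_ j i x = - 2 * ln (X (W_ j) i x) by rewrite /X expRK; field.
pose l := limn (fun j => X (W_ j) i x).
have l0 : 0 <= l.
  by apply: limr_ge => //; apply: nearW => j; exact: expR_ge0.
(* A limit 0 of the exponentials would send [W_] to infinity, against the finiteness of [f i x]; a
   positive limit allows taking logarithms. *)
move: l0; rewrite le_eqVlt => /predU1P[l0|l0].
  have Woo : (W_ j i x)%:E @[j --> \oo] --> +oo%E.
    apply/cvgeryP/cvgryPge => A.
    have /cvgrPdist_lt /(_ (expR (- (A / 2))) (expR_gt0 _)) : X (W_ j) i x @[j --> \oo] --> 0.
      by rewrite l0.
    apply: filterS => j; rewrite sub0r normrN ger0_norm ?expR_ge0// ltr_expR ltrN2.
    by rewrite ltr_pM2r ?invr_gt0// => /ltW.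
  by move: fx; rewrite /f (cvg_limn_einf_sup Woo).1.
have Wl : W_ j i x @[j --> \oo] --> - 2 * ln l.
  rewrite (_ : (fun j => _) = (fun j => - 2 * ln (X (W_ j) i x))); last exact/funext.
  apply: cvgMr; apply: continuous_cvg => //.
  exact: continuous_ln.
have Wl' : (W_ j i x)%:E @[j --> \oo] --> (- 2 * ln l)%:E.
  by apply/fine_cvgP; split; [exact: nearW|exact: Wl].
by rewrite /f (cvg_limn_einf_sup Wl').1.
Qed.

End komlos.

(** * The limit is attained by some cocycle *)

Section last_passage.
Context (R : realType) (d : nat) (G : ptopologicalType).
Local Notation Omega := (environment d G).
Context (steps : {fset site d}) (V : Omega -> site d -> R) (h : 'rV[R]_d).
Hypothesis steps_neq0 : steps != fset0.

Lemma dotD x y : dot h (x + y) = dot h x + dot h y.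
Proof.
rewrite /dot -big_split/=; apply: eq_bigr => i _.
by rewrite /embed !mxE intrD mulrDr.
Qed.

Lemma dot0 : dot h (0 : site d) = 0.
Proof. by rewrite /dot big1// => i _; rewrite /embed !mxE mulr0. Qed.

Lemma path_value_cons n w (x : nat -> site d) : x 0%N = 0 ->
  path_value V h n.+1 w x = V w (x 1%N) + dot h (x 1%N) +
    path_value V h n (env_shift (x 1%N) w) (fun k => x k.+1 - x 1%N).
Proof.
move=> x0; rewrite /path_value big_ord_recl x0 env_shift0 subr0 -!addrA; congr (_ + _).
have -> : dot h (x n.+1) = dot h (x 1%N) + dot h (x n.+1 - x 1%N).
  by rewrite -dotD addrC subrK.
rewrite addrCA; congr (_ + (_ + _)); apply: eq_bigr => k _.
have e : x 1%N + (x k.+1 - x 1%N) = x k.+1 by rewrite addrC subrK.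
by rewrite env_shiftD e lift0 opprB addrA subrK.
Qed.

Lemma point_to_level0 w : point_to_level steps V h 0 w = 0.
Proof.
have [x [x0 _] [<- _]] := point_to_level_max V h 0 w steps_neq0.
by rewrite /path_value big_ord0 add0r x0 dot0.
Qed.

Lemma point_to_level_ge n w z : z \in steps ->
  V w z + dot h z + point_to_level steps V h n (env_shift z w) <=
  point_to_level steps V h n.+1 w.
Proof.
move=> zs.
have [x [x0 xs] [<- _]] := point_to_level_max V h n (env_shift z w) steps_neq0.
have [_y _ [yE ymax]] := point_to_level_max V h n.+1 w steps_neq0.
rewrite -yE; pose y k := if k is k'.+1 then z + x k' else 0.
have y1 : y 1%N = z by rewrite /y x0 addr0.
apply: le_trans (ymax y _); last first.
  split => // -[_|k kn]; first by rewrite y1 subr0.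
  by rewrite /y opprD addrACA subrr add0r; exact: xs.
rewrite path_value_cons// y1.
have -> : (fun k => y k.+1 - z) = x by apply/funext => k; rewrite /y addrC addKr.
by [].
Qed.

Lemma point_to_level_attained n w : exists2 z, z \in steps &
  point_to_level steps V h n.+1 w =
  V w z + dot h z + point_to_level steps V h n (env_shift z w).
Proof.
have [x [x0 xs] [e _]] := point_to_level_max V h n.+1 w steps_neq0.
have zs : x 1%N \in steps by have := xs 0%N isT; rewrite x0 subr0.
exists (x 1%N) => //; apply/eqP; rewrite eq_le point_to_level_ge// andbT.
rewrite -e path_value_cons// lerD2l.
have [_y _ [<- ymax]] := point_to_level_max V h n (env_shift (x 1%N) w) steps_neq0.
by apply: ymax; split => [|k kn]; rewrite ?subrr// opprB addrA subrK; exact: xs.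
Qed.

Context (P : probability Omega R).
Hypothesis P_iid : iid_product P.
Hypothesis V_integrable :
  forall z, z \in steps -> P.-integrable setT (EFin \o (V ^~ z)).

Let integrable_one_step n z : z \in steps ->
  P.-integrable setT (EFin \o point_to_level steps V h n) ->
  P.-integrable setT (EFin \o
    (fun w => V w z + dot h z + point_to_level steps V h n (env_shift z w))).
Proof.
move=> zs Gi; apply: integrableDR; last exact: (integrable_shift P_iid z Gi).
by apply: integrableDR; [exact: V_integrable|exact: integrable_cstR].
Qed.

Lemma integrable_point_to_level n :
  P.-integrable setT (EFin \o point_to_level steps V h n).
Proof.
elim: n => [|n IH].
  rewrite (_ : point_to_level _ _ _ _ = (fun=> 0)); first exact: integrable_cstR.
  by apply/funext => w; rewrite point_to_level0.
pose f z w := V w z + dot h z + point_to_level steps V h n (env_shift z w).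
have fi z : z \in steps -> P.-integrable setT (EFin \o f z) by move=> zs; exact: integrable_one_step.
have [z0 z0s] := fset0Pn _ steps_neq0.
(* The default [f z0] leaves the maximum unchanged and makes the family integrable at every
   index. *)
pose f' z := if z \in steps then f z else f z0.
have f'i z : P.-integrable setT (EFin \o f' z).
  by rewrite /f'; case: ifPn => zs; exact: fi.
have GE : point_to_level steps V h n.+1 =
    (fun w => \big[Num.max/f z0 w]_(z <- steps) f' z w).
  apply/funext => w; apply/eqP; rewrite eq_le; apply/andP; split.
    have [z zs ->] := point_to_level_attained n w.
    have -> : V w z + dot h z + point_to_level steps V h n (env_shift z w) = f' z w.
      by rewrite /f' zs.
    exact: (@le_bigmax_seq _ _ _ _ _ _ xpredT (f' ^~ w) zs).
  apply: bigmax_le => [|z _]; first exact: point_to_level_ge.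
  by rewrite /f'; case: ifPn => zs; exact: point_to_level_ge.
apply: (le_integrable measurableT _ _ (g := EFin \o (fun w => \sum_(z <- steps) `|f' z w|))).
- apply/measurable_EFinP; rewrite GE.
  have mbig s : measurable_fun setT (fun w => \big[Num.max/f z0 w]_(z <- s) f' z w).
    elim: s => [|z s IHs].
      rewrite (_ : (fun w => _) = f z0); last by apply/funext => w; rewrite big_nil.
      exact: integrable_measurableR (fi _ z0s).
    rewrite (_ : (fun w => _) =
      (fun w => Num.max (f' z w) (\big[Num.max/f z0 w]_(z <- s) f' z w))); last first.
      by apply/funext => w; rewrite big_cons.
    by apply: measurable_maxr => //; exact: integrable_measurableR (f'i z).
  exact: mbig.
- move=> w _; rewrite /= lee_fin [leRHS]ger0_norm ?sumr_ge0//.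
  have [z zs ->] := point_to_level_attained n w.
  rewrite (big_rem z)//= /f' zs -/(f z w) lerDl; exact: sumr_ge0.
- by apply: integrable_sumR => z; exact: integrable_normR.
Qed.

End last_passage.

(** * Truncated averages and the limiting cocycle *)

Section corrector.
Context (R : realType) (d : nat) (G : ptopologicalType).
Local Notation Omega := (environment d G).
Context (steps : {fset site d}) (V : Omega -> site d -> R) (h : 'rV[R]_d).
Hypothesis steps_neq0 : steps != fset0.
Context (P : probability Omega R).
Hypothesis P_iid : iid_product P.
Hypothesis V_integrable :
  forall z, z \in steps -> P.-integrable setT (EFin \o (V ^~ z)).
Context (g : R).
Hypothesis g_limit : {ae P, forall w,
  n%:R^-1 * point_to_level steps V h n w @[n --> \oo] --> g}.

(* Truncating the last-passage values at [K * n] bounds the increments of their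
   averages [U N] above by the fixed integrable [B0], which is what [komlos] needs;
   the cost [err] of the truncation vanishes almost surely since [g < K]. *)
Let K : R := `|g| + 1.
Let pl n w : R := point_to_level steps V h n w.
Let tpl n w : R := Num.min (pl n w) (K * n%:R).
Let excess z w : R := Num.max (V w z + dot h z - K) 0.
Let err z n w : R := if K * n%:R < pl n w then excess z w else 0.
Let B0 z w : R := K + excess z w.
(** What remains after averaging [tpl_step] and shifting the index: a boundary term and the
    truncation errors. *)
Let D N z w : R := N.+1%:R^-1 * (tpl N.+1 (env_shift z w) + \sum_(n < N.+1) err z n.+1 w).
Let U N w : R := N.+1%:R^-1 * \sum_(n < N.+1) tpl n.+1 w.

Let excess_ge0 z w : 0 <= excess z w.
Proof. by rewrite le_max lexx orbT. Qed.

(** Where the truncation acts at [w], the two truncation levels differ by [K], and [excess] covers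
    the rest; elsewhere the recursion survives, since truncating its left side only lowers it. *)
Let tpl_step z n w : z \in steps ->
  V w z + dot h z + tpl n (env_shift z w) - tpl n.+1 w <= err z n.+1 w.
Proof.
move=> zs; rewrite /err /tpl; case: (ltP (K * n.+1%:R) (pl n.+1 w)) => Kpl.
  apply: (@le_trans _ _ (V w z + dot h z + K * n%:R - K * n.+1%:R)).
    by rewrite lerD2r lerD2l ge_min lexx orbT.
  rewrite -natr1 /excess le_max; apply/orP; left; lra.
rewrite subr_le0; apply: le_trans (point_to_level_ge V h steps_neq0 n w zs).
by rewrite lerD2l ge_min lexx.
Qed.

Let U_increment z N w : z \in steps ->
  V w z + dot h z + U N (env_shift z w) - U N w <= D N z w.
Proof.
move=> zs; have T0 : N.+1%:R != 0 :> R by [].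
have shift_sum : \sum_(n < N.+1) tpl n.+1 (env_shift z w) =
    \sum_(n < N.+1) tpl n (env_shift z w) + tpl N.+1 (env_shift z w).
  transitivity (\sum_(n < N.+2) tpl n (env_shift z w)); last by rewrite big_ord_recr.
  rewrite [RHS]big_ord_recl /= (_ : tpl 0 _ = 0) ?add0r//.
  by rewrite /tpl /pl point_to_level0// mulr0 minxx.
have : \sum_(n < N.+1) (V w z + dot h z + tpl n (env_shift z w) - tpl n.+1 w)
    <= \sum_(n < N.+1) err z n.+1 w by apply: ler_sum => n _; exact: tpl_step.
rewrite sumrB big_split/= sumr_const card_ord -mulr_natl => le.
rewrite /D /U shift_sum -subr_ge0.
set a := V w z + dot h z in le *; set s0 := \sum_(n < N.+1) tpl n _ in le *.
set s := \sum_(n < N.+1) tpl n.+1 w in le *; set e := \sum_(n < N.+1) _ in le *.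
set t := tpl _ _.
have -> : N.+1%:R^-1 * (t + e) - (a + N.+1%:R^-1 * (s0 + t) - N.+1%:R^-1 * s) =
   N.+1%:R^-1 * (e - (N.+1%:R * a + s0 - s)) by field.
by rewrite mulr_ge0// subr_ge0.
Qed.

Let D_le N z w : D N z w <= B0 z w.
Proof.
rewrite /D /B0 mulrC ler_pdivrMr// mulrDl; apply: lerD.
  by rewrite ge_min lexx orbT.
apply: le_trans (ler_sum _ (_ : forall n : 'I_N.+1, true -> err z n.+1 w <= excess z w)) _.
  by move=> n _; rewrite /err; case: ifP.
by rewrite sumr_const card_ord mulr_natr.
Qed.

(** Because [g < K], only finitely many [err] terms are nonzero at a given [w], and division by
    [N.+1] removes them; the boundary term is controlled by the limit at the shifted environment. *)
Let D_eventually z : {ae P, forall w, forall e : R, g < e ->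
  exists n0, forall N, (n0 <= N)%N -> D N z w <= e}.
Proof.
have := ae_shift P_iid g_limit.
move: g_limit; apply: filterS2 => w gw gsw e ge.
pose r := (e - g) / 2.
have r0 : 0 < r by rewrite divr_gt0// subr_gt0.
have [n1 _ n1P] : \forall n \near \oo, n%:R^-1 * pl n (env_shift z w) <= g + r.
  apply: (cvgr_le _ (gsw z)); rewrite ltrDl; exact: r0.
have [n2 _ n2P] : \forall n \near \oo, n%:R^-1 * pl n w <= K.
  apply: (cvgr_le _ gw); rewrite /K.
  by rewrite (le_lt_trans (ler_norm g))// ltrDl.
pose n3 := (Num.truncn (n2%:R * excess z w / r)).+1.
exists (maxn n1 (maxn n2 n3)) => N; rewrite !geq_max => /and3P[n1N n2N n3N].
have N0 : 0 < N.+1%:R :> R by [].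
rewrite /D mulrDr.
have -> : e = (g + r) + r by rewrite /r; field.
apply: lerD.
  apply: le_trans (n1P N.+1 _); last exact: leqW.
  by rewrite ler_pM2l ?invr_gt0// ge_min lexx.
rewrite mulrC ler_pdivrMr//.
apply: (@le_trans _ _ (n2%:R * excess z w)); last first.
  rewrite mulrC [r * _]mulrC -ler_pdivrMr// mulrC ltW//.
  by apply: lt_le_trans (truncnS_gt _) _; rewrite ler_nat; apply: leqW.
apply: (@le_trans _ _ (\sum_(n < N.+1) if (n < n2)%N then excess z w else 0)).
  apply: ler_sum => n _; rewrite /err; case: ifPn => [Kn|_]; last by case: ifP.
  case: ltnP => // n2n; move: Kn; rewrite ltNge => /negP; case.
  have := n2P n.+1 (leqW n2n); rewrite mulrC ler_pdivrMr//.
have -> T : \sum_(n < T) (if (n < n2)%N then excess z w else 0) =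
    (minn T n2)%:R * excess z w.
  elim: T => [|T IH]; first by rewrite big_ord0 min0n mul0r.
  rewrite big_ord_recr/= IH; case: ltnP => Tn.
    by rewrite (minn_idPl Tn) -[T.+1%:R]natr1 mulrDl mul1r.
  by rewrite (minn_idPr (leqW Tn)) addr0.
by rewrite ler_wpM2r// ler_nat geq_minr.
Qed.

(** A stand-in for the convex hull of the [U N] with [N >= n]: the conditions are stable under
    midpoints and weaken as [n] decreases, so no convex weights need be carried along. *)
Let S n (u : Omega -> R) := [/\ P.-integrable setT (EFin \o u),
  forall z w, z \in steps ->
    V w z + dot h z + u (env_shift z w) - u w <= B0 z w &
  forall z w e, z \in steps -> (forall N, (n <= N)%N -> D N z w <= e) ->
    V w z + dot h z + u (env_shift z w) - u w <= e].

Let S_nonempty n : S n (U n).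
Proof.
split.
- rewrite /U; apply: integrableZR; apply: integrable_sumR => k.
  have pi := integrable_point_to_level h steps_neq0 P_iid V_integrable k.+1.
  apply: (le_integrable measurableT _ _ (g := EFin \o (fun w => `|pl k.+1 w| + K * k.+1%:R))).
  + apply/measurable_EFinP; apply: measurable_minr => //.
    exact: integrable_measurableR pi.
  + move=> w _; rewrite /= lee_fin /tpl.
    have KK : 0 <= K * k.+1%:R by rewrite mulr_ge0// addr_ge0.
    rewrite [leRHS]ger0_norm ?addr_ge0//.
    by rewrite /Num.min; case: ifP => _; [rewrite lerDl|rewrite ger0_norm// lerDr].
  + by apply: integrableDR; [exact: integrable_normR|exact: integrable_cstR].
- by move=> z w zs; apply: le_trans (U_increment _ _ zs) (D_le _ _ _).
- by move=> z w e zs; move=> /(_ n (leqnn n)); apply: le_trans (U_increment _ _ zs).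
Qed.

Lemma coboundary_limit : exists (u : nat -> Omega -> R) (f : site d -> Omega -> R),
  [/\ forall j, P.-integrable setT (EFin \o u j),
      forall z, z \in steps -> P.-integrable setT (EFin \o f z),
      forall z, z \in steps -> 0 <= \int[P]_w f z w,
      forall z, z \in steps -> {ae P, forall w,
        u j (env_shift z w) - u j w @[j --> \oo] --> f z w} &
      forall z, z \in steps -> {ae P, forall w, V w z + dot h z + f z w <= g}].
Proof.
(* The gap between the increment of [u] and its upper bound [B0]; membership in [S] makes it
   nonnegative, as [komlos] requires. *)
pose Wf (u : Omega -> R) (i : steps) w :=
  B0 (val i) w - V w (val i) - dot h (val i) - (u (env_shift (val i) w) - u w).
pose base (i : steps) w := B0 (val i) w - V w (val i) - dot h (val i).
have ex_i z : z \in steps -> P.-integrable setT (EFin \o excess z).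
  move=> zs; have Vi : P.-integrable setT (EFin \o (fun w => V w z + dot h z - K)).
    by apply: integrableBR; [apply: integrableDR|]; [exact: V_integrable|exact: integrable_cstR..].
  apply: (le_integrable measurableT _ _ (integrable_normR Vi)).
    by apply/measurable_EFinP; apply: measurable_maxr => //; exact: integrable_measurableR Vi.
  move=> w _; rewrite /= lee_fin normr_id ger0_norm ?excess_ge0// /excess.
  by rewrite ge_max ler_norm normr_ge0.
have bi i : P.-integrable setT (EFin \o base i).
  apply: integrableBR; last exact: integrable_cstR.
  apply: integrableBR; last exact: V_integrable (valP i).
  by apply: integrableDR; [exact: integrable_cstR|exact: ex_i (valP i)].
have ui (u : Omega -> R) (i : steps) : P.-integrable setT (EFin \o u) ->
    P.-integrable setT (EFin \o (fun w => u (env_shift (val i) w) - u w)).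
  by move=> u_i; apply: integrableBR => //; exact: (integrable_shift P_iid _ u_i).
pose C n : set (steps -> Omega -> R) := [set Wf u | u in S n].
pose M i := \int[P]_w base i w.
have [] := @komlos _ _ _ P steps C M.
- move=> n m nm _ [u [u_i uB uD] <-]; exists u => //; split => // z w e zs De.
  by apply: uD => // N mN; apply: De; exact: leq_trans mN.
- by move=> n; exists (Wf (U n)); exists (U n); first exact: S_nonempty.
- move=> n _ _ [u [u_i uB uD] <-] [v [v_i vB vD] <-].
  exists (fun w => 2^-1 * (u w + v w)).
    split.
    + by apply: integrableZR; exact: integrableDR.
    + by move=> z w zs; have := uB z w zs; have := vB z w zs; lra.
    + by move=> z w e zs De; have := uD z w e zs De; have := vD z w e zs De; lra.
  by apply/funext => i; apply/funext => w; rewrite /Wf; field.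
- move=> _ [u [u_i uB uD] <-] i.
  have Wi : P.-integrable setT (EFin \o Wf u i) by exact: (integrableBR (bi i) (ui _ i u_i)).
  split.
  + exact: integrable_measurableR Wi.
  + by move=> w; have := uB (val i) w (valP i); rewrite /Wf; lra.
  (* The increment [u (env_shift z w) - u w] has mean zero, so the mean of the gap is [M i] whatever
     [u] is. *)
  + rewrite -EFin_RintegralP// lee_fin /Wf RintegralB//; [|exact: bi|exact: ui].
    rewrite [X in _ - X]RintegralB//; last exact: (integrable_shift P_iid _ u_i).
    by rewrite (Rintegral_shift P_iid _ u_i) subrr subr0.
move=> W_ [W [CW Wi WM Wcvg]].
have [u uP] : exists u : nat -> Omega -> R, forall j, S j (u j) /\ W_ j = Wf (u j).
  have /choice[u uP] : forall j, exists u, S j u /\ W_ j = Wf u.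
    by move=> j; have [u Su <-] := CW j; exists u.
  by exists u.
pose f z w := if insub z is Some i then base i w - W i w else 0.
have fE z (zs : z \in steps) w : f z w = base [`zs]%fset w - W [`zs]%fset w.
  rewrite /f; case: insubP => [i _ iz|]; last by rewrite zs.
  by have -> : i = [`zs]%fset by apply/val_inj.
have fi z : z \in steps -> P.-integrable setT (EFin \o f z).
  move=> zs; rewrite (_ : f z = (fun w => base [`zs]%fset w - W [`zs]%fset w)).
    exact: integrableBR.
  by apply/funext => w; rewrite fE.
have ucvg z : z \in steps -> {ae P, forall w,
    u j (env_shift z w) - u j w @[j --> \oo] --> f z w}.
  move=> zs; apply: filterS Wcvg => w /(_ [`zs]%fset) Ww.
  rewrite fE (_ : (fun j => _) = (fun j => base [`zs]%fset w - W_ j [`zs]%fset w)).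
    by apply: cvgB => //; exact: cvg_cst.
  by apply/funext => j; have [_ ->] := uP j; rewrite /Wf /base/=; lra.
exists u, f; split => //.
- by move=> j; have [[]] := uP j.
- move=> z zs.
  rewrite (_ : \int[P]_w f z w = \int[P]_w (base [`zs]%fset w - W [`zs]%fset w)).
    by rewrite RintegralB// subr_ge0; exact: WM.
  by apply: eq_Rintegral => w _; rewrite fE.
- move=> z zs; apply: filterS2 (ucvg z zs) (D_eventually z) => w uw Dw.
  apply/ler_addgt0Pr => e e0.
  have [|n0 n0P] := Dw (g + e); first by rewrite ltrDl.
  have cv : V w z + dot h z + (u j (env_shift z w) - u j w) @[j --> \oo]
      --> V w z + dot h z + f z w by apply: cvgD => //; exact: cvg_cst.
  apply: (cvgr_to_le cv); exists n0 => // j n0j.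
  have [[_ _ uD] _] := uP j; rewrite addrA; apply: uD => // N jN.
  by apply: n0P; exact: leq_trans jN.
Qed.

Hypothesis steps_span : additive_span steps = [set: site d].

(** The good sites form a subgroup: the increment along [a - b] at [w] is the increment along [a]
    minus that along [b], both based at [env_shift (- b) w]. *)
Lemma coboundary_limit_everywhere (u : nat -> Omega -> R) (f : site d -> Omega -> R) :
  (forall z, z \in steps -> P.-integrable setT (EFin \o f z)) ->
  (forall z, z \in steps -> {ae P, forall w,
     u j (env_shift z w) - u j w @[j --> \oo] --> f z w}) ->
  forall x, exists fx : Omega -> R, P.-integrable setT (EFin \o fx) /\
    {ae P, forall w, u j (env_shift x w) - u j w @[j --> \oo] --> fx w}.
Proof.
move=> fi ucvg x.
pose H := [set x : site d | exists fx : Omega -> R, P.-integrable setT (EFin \o fx) /\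
    {ae P, forall w, u j (env_shift x w) - u j w @[j --> \oo] --> fx w}].
suff : H x by [].
have : additive_span steps x by rewrite steps_span.
apply; split; last by move=> z zs; exists (f z); split; [exact: fi|exact: ucvg].
split.
  rewrite inE; exists (fun=> 0); split; first exact: integrable_cstR.
  apply: aeW => w; rewrite (_ : (fun j => _) = (fun=> 0)); first exact: cvg_cst.
  by apply/funext => j; rewrite env_shift0 subrr.
move=> a b; rewrite !inE => -[fa [fai fac]] [fb [fbi fbc]].
exists (fun w => fa (env_shift (- b) w) - fb (env_shift (- b) w)); split.
  by apply: integrableBR; apply: (integrable_shift P_iid).
have := ae_shift P_iid fbc; have := ae_shift P_iid fac.
apply: filterS2 => w /(_ (- b)) ca /(_ (- b)) cb.
rewrite (_ : (fun j => _) = (fun j =>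
  (u j (env_shift a (env_shift (- b) w)) - u j (env_shift (- b) w)) -
  (u j (env_shift b (env_shift (- b) w)) - u j (env_shift (- b) w)))).
  exact: cvgB.
apply/funext => j; rewrite !env_shiftD [- b + b]addrC subrr env_shift0 [- b + a]addrC.
by lra.
Qed.

Lemma exists_corrector : exists2 F, centered_cocycles P F &
  {ae P, forall w, forall z, z \in steps -> V w z + dot h z + F w 0 z <= g}.
Proof.
have [u [f [ui fi f0 ucvg fg]]] := coboundary_limit.
have /choice[fx fxP] := coboundary_limit_everywhere fi ucvg.
have fxi x : P.-integrable setT (EFin \o fx x) by have [] := fxP x.
have fxc : {ae P, forall w, forall x, forall a,
    u j (env_shift a (env_shift x w)) - u j (env_shift x w) @[j --> \oo] -->
    fx a (env_shift x w)}.
  have fxc0 : {ae P, forall w, forall a,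
      u j (env_shift a w) - u j w @[j --> \oo] --> fx a w}.
    by apply: ae_forall_countable => a; have [] := fxP a.
  exact: filterS (ae_shift P_iid fxc0).
have fxD : {ae P, forall w, forall x a b,
    fx a (env_shift x w) + fx b (env_shift (x + a) w) = fx (a + b) (env_shift x w)}.
  apply: filterS fxc => w c x a b.
  apply: (cvg_unique (@norm_hausdorff _ _) _ (c x (a + b))).
  rewrite (_ : (fun j => _) = (fun j =>
    (u j (env_shift a (env_shift x w)) - u j (env_shift x w)) +
    (u j (env_shift b (env_shift (x + a) w)) - u j (env_shift (x + a) w)))).
    exact: cvgD (c x a) (c (x + a) b).
  by apply/funext => j /=; rewrite !env_shiftD addrA; lra.
(* The means are additive in [x], so subtracting them preserves the cocycle relation; being
   nonnegative on the steps, they only lower the values that must stay below [g]. *)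
pose c x := \int[P]_w fx x w.
have cD a b : c a + c b = c (a + b).
  rewrite /c -[X in _ + X](Rintegral_shift P_iid a)// -RintegralD//; last exact: (integrable_shift P_iid).
  congr fine; apply: ae_eq_integral => //.
  - by apply/measurable_EFinP; apply: measurable_funD;
      [exact: integrable_measurableR (fxi _)|
       exact: integrable_measurableR (integrable_shift P_iid a (fxi b))].
  - by apply/measurable_EFinP; exact: integrable_measurableR (fxi _).
  - apply: filterS fxD => w /(_ 0 a b) + _; rewrite env_shift0 add0r => e.
    by rewrite /= e.
pose F w x y := fx (y - x) (env_shift x w) - c (y - x).
have Fi x y : P.-integrable setT (EFin \o (fun w => F w x y)).
  by apply: integrableBR; [exact: (integrable_shift P_iid)|exact: integrable_cstR].
exists F.
  split; last first.
    move=> x y; rewrite unlock -EFin_RintegralP// RintegralB//.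
    - by rewrite Rintegral_cstP (Rintegral_shift P_iid)// subrr.
    - exact: (integrable_shift P_iid).
    - exact: integrable_cstR.
  split.
    split; first by move=> x y; exact: integrable_measurableR (Fi x y).
    apply: filterS fxD => w wD x y z; split.
      by rewrite /F env_shiftD opprD addrACA subrr addr0 [z + x]addrC.
    rewrite /F; have := wD x (y - x) (z - y).
    have := cD (y - x) (z - y).
    have -> : x + (y - x) = y by rewrite addrC subrK.
    have -> : y - x + (z - y) = z - x by rewrite addrC addrA subrK.
    by move=> <- <-; lra.
  by move=> x y; rewrite unlock; have /integrableP[_ iF] := Fi x y; exact: iF.
have cge0 z : z \in steps -> {ae P, forall w, V w z + dot h z + F w 0 z <= g}.
  move=> zs.
  have eqf : {ae P, forall w, fx z w = f z w}.
    have [_ fxz] := fxP z; apply: filterS2 fxz (ucvg z zs) => w c1 c2.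
    exact: (cvg_unique (@norm_hausdorff _ _) c1 c2).
  have c0 : 0 <= c z.
    rewrite /c; have := f0 z zs; congr (0 <= fine _); apply: ae_eq_integral => //.
    - by apply/measurable_EFinP; exact: integrable_measurableR (fi z zs).
    - by apply/measurable_EFinP; exact: integrable_measurableR (fxi _).
    - by apply: filterS eqf => w e _; rewrite /= e.
  apply: filterS2 eqf (fg z zs) => w e; rewrite /F subr0 env_shift0 e; lra.
apply: ae_forall_countable => z.
case: (boolP (z \in steps)) => zs; last exact: aeW.
by apply: filterS (cge0 z zs) => w ? _.
Qed.

End corrector.

(** * Tail bounds *)

Section tails.
Context (R : realType) d (T : measurableType d) (P : probability T R).

Lemma measurable_superlevel (f : T -> R) (c : R) : measurable_fun setT f ->
  measurable [set x | c <= f x].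
Proof.
move=> mf; have -> : [set x | c <= f x] = f @^-1` `[c, +oo[.
  by apply/seteqP; split=> x /=; rewrite in_itv/= andbT.
by rewrite -[X in measurable X]setTI; apply: mf => //; exact: measurable_itv.
Qed.

Lemma measurable_strict_superlevel (f : T -> R) (c : R) : measurable_fun setT f ->
  measurable [set x | c < f x].
Proof.
move=> mf; have -> : [set x | c < f x] = f @^-1` `]c, +oo[.
  by apply/seteqP; split=> x /=; rewrite in_itv/= andbT.
by rewrite -[X in measurable X]setTI; apply: mf => //; exact: measurable_itv.
Qed.

Definition pr (A : set T) : R := fine (P A).

Lemma prE (A : set T) : measurable A -> (pr A)%:E = P A.
Proof. by move=> mA; rewrite /pr fineK// fin_num_measure. Qed.

Lemma pr_ge0 (A : set T) : 0 <= pr A.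
Proof. exact: fine_ge0. Qed.

Lemma pr_le (A B : set T) : measurable A -> measurable B -> A `<=` B ->
  pr A <= pr B.
Proof. by move=> mA mB AB; rewrite -lee_fin !prE// le_measure// inE. Qed.

Lemma prU (A B : set T) : measurable A -> measurable B ->
  pr (A `|` B) <= pr A + pr B.
Proof.
move=> mA mB; rewrite -lee_fin EFinD !prE//; last exact: measurableU.
exact: measureU2.
Qed.

Lemma exists_union (I : finType) (A : I -> set T) (p : R) :
  (forall i, measurable (A i)) -> (forall i, pr (A i) <= p) ->
  measurable [set x | exists i, A i x] /\ pr [set x | exists i, A i x] <= #|I|%:R * p.
Proof.
move=> mA Ap; rewrite cardE.
have -> : [set x | exists i, A i x] = [set x | exists2 i, i \in enum I & A i x].
  by apply/seteqP; split=> x /= [i]; [exists i; rewrite ?mem_enum|move=> _ ?; exists i].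
elim: (enum I) => [|i s [ms IH]].
  have -> : [set x | exists2 i, i \in [::] & A i x] = set0.
    by apply/seteqP; split=> x //= [].
  by split => //; rewrite /pr measure0 mul0r.
have -> : [set x | exists2 j, j \in i :: s & A j x] =
    A i `|` [set x | exists2 j, j \in s & A j x].
  apply/seteqP; split=> x /=.
    by move=> [j]; rewrite inE => /predU1P[->|js] Aj; [left|right; exists j].
  by move=> [Ai|[j js Aj]]; [exists i; rewrite ?mem_head|exists j; rewrite // inE js orbT].
split; first exact: measurableU.
by apply: le_trans (prU _ _) _ => //; rewrite /= -natr1 mulrDl mul1r addrC lerD.
Qed.

Lemma markov_inequality (f : T -> R) (c : R) : P.-integrable setT (EFin \o f) ->
  (forall x, 0 <= f x) -> 0 < c -> pr [set x | c <= f x] <= (\int[P]_x f x) / c.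
Proof.
move=> fi f0 c0; have mf := integrable_measurableR fi.
have mA := measurable_superlevel c mf.
set A := [set x | c <= f x] in mA *.
have Ai : P.-integrable setT (EFin \o (\1_A : T -> R)).
  apply: (@prob_bounded_integrable _ _ _ _ 1).
    exact: measurable_indic.
  by move=> w; rewrite indicE; case: (_ \in _); rewrite ?normr1 ?normr0.
rewrite ler_pdivlMr//.
have -> : pr A * c = \int[P]_x (c * \1_A x).
  by rewrite RintegralZl// /Rintegral integral_indic// setIT mulrC.
apply: le_Rintegral => //; first exact: integrableZR.
move=> x _; rewrite indicE; case: (boolP (x \in A)) => [|_]; last by rewrite mulr0.
by rewrite inE mulr1.
Qed.

(* Tail condition matched to the scales used below: with box radius of order
   [j ^ B.+1] and truncation level of order [j ^ B], the union bound over an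
   [n]-dimensional box is negligible. *)
Definition thin_tail (n : nat) (f : T -> R) := exists B0 : nat,
  forall B, (B0 <= B)%N -> forall s eps : R, 0 < s -> 0 < eps ->
  exists j0, forall j, (j0 <= j)%N ->
    (j ^ (B.+1 * n))%:R * pr [set x | s * j%:R ^+ B < f x] <= eps.

Lemma thin_tail_cst n (c : R) : thin_tail n (fun=> c).
Proof.
exists 1%N => B B1 s eps s0 eps0; exists (Num.truncn (`|c| / s)).+1 => j jc.
have j1 : 1 <= j%:R :> R by rewrite ler1n (leq_ltn_trans _ jc).
have -> : [set x : T | s * j%:R ^+ B < c] = set0.
  apply/seteqP; split => x //=; rewrite ltNge => /negP; apply.
  apply: le_trans (ler_norm _) _; rewrite mulrC -ler_pdivrMr//.
  apply: (@le_trans _ _ j%:R); last by rewrite -[leLHS]expr1 ler_weXn2l.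
  by apply: ltW; apply: lt_le_trans (truncnS_gt _) _; rewrite ler_nat.
by rewrite /pr measure0 mulr0 ltW.
Qed.

Lemma thin_tailD n (f g : T -> R) : measurable_fun setT f -> measurable_fun setT g ->
  thin_tail n f -> thin_tail n g -> thin_tail n (fun x => f x + g x).
Proof.
move=> mf mg [Bf tf] [Bg tg]; exists (maxn Bf Bg) => B; rewrite geq_max => /andP[Bf' Bg'].
move=> s eps s0 eps0.
have s2 : 0 < s / 2 by rewrite divr_gt0.
have eps2 : 0 < eps / 2 by rewrite divr_gt0.
have [jf jfP] := tf B Bf' _ _ s2 eps2; have [jg jgP] := tg B Bg' _ _ s2 eps2.
exists (maxn jf jg) => j; rewrite geq_max => /andP[/jfP hf /jgP hg].
have mA := measurable_strict_superlevel (s / 2 * j%:R ^+ B) mf.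
have mB := measurable_strict_superlevel (s / 2 * j%:R ^+ B) mg.
have mC := measurable_strict_superlevel (s * j%:R ^+ B) (measurable_funD mf mg).
apply: (@le_trans _ _ ((j ^ (B.+1 * n))%:R * (pr [set x | s / 2 * j%:R ^+ B < f x] +
   pr [set x | s / 2 * j%:R ^+ B < g x]))).
  rewrite ler_wpM2l//; apply: le_trans (prU mA mB); apply: pr_le => //.
    exact: measurableU.
  move=> x /= h; case: (ltP (s / 2 * j%:R ^+ B) (f x)) => hf'; [by left|right].
  by move: h hf'; lra.
rewrite mulrDr; lra.
Qed.

Lemma thin_tail_sum n (I : Type) (s : seq I) (f : I -> T -> R) :
  (forall i, measurable_fun setT (f i)) -> (forall i, thin_tail n (f i)) ->
  thin_tail n (fun x => \sum_(i <- s) f i x).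
Proof.
move=> mf tf; elim: s => [|i s IH].
  rewrite (_ : (fun x => _) = (fun=> 0)); first exact: thin_tail_cst.
  by apply/funext => x; rewrite big_nil.
rewrite (_ : (fun x => _) = (fun x => f i x + \sum_(j <- s) f j x)); last first.
  by apply/funext => x; rewrite big_cons.
by apply: thin_tailD => //; exact: measurable_sum.
Qed.

(** Markov's inequality for the [q]-th power gives a tail of order [j ^ (- B q)], against
    [j ^ (B.+1 * n)] sites. *)
Lemma thin_tail_Lfun n (f : T -> R) (q : R) : n%:R < q -> 1 <= q ->
  f \in Lfun P q%:E -> thin_tail n (fun x => `|f x|).
Proof.
move=> nq q1 fL.
have fi := Lfun_integrable q1 fL.
have mf : measurable_fun setT f by move: fL; rewrite inE => /andP[]; rewrite inE.
set m := \int[P]_x (`|f x| `^ q).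
have m0 : 0 <= m by apply: Rintegral_ge0 => x _; exact: powR_ge0.
have qn : 0 < q - n%:R by rewrite subr_gt0.
have q0 : 0 < q by exact: lt_le_trans q1.
(* From this [B] on, [B q >= B.+1 * n + 1], which leaves a spare factor [j]. *)
exists (Num.truncn (n.+1%:R / (q - n%:R))).+1 => B BB s eps s0 eps0.
have Bq : (B * n + n.+1)%:R <= B%:R * q.
  have : n.+1%:R <= B%:R * (q - n%:R).
    rewrite -ler_pdivrMr// ltW//.
    by apply: lt_le_trans (truncnS_gt _) _; rewrite ler_nat.
  by rewrite natrD natrM; lra.
have sq : 0 < s `^ q by exact: powR_gt0.
exists (Num.truncn (m / s `^ q / eps)).+1 => j jj.
have j1 : (0 < j)%N by exact: leq_ltn_trans jj.
have j0 : 0 < j%:R :> R by rewrite ltr0n.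
have a0 : 0 < s * j%:R ^+ B by rewrite mulr_gt0// exprn_gt0.
have tail : pr [set x | s * j%:R ^+ B < `|f x|] <= m / (s * j%:R ^+ B) `^ q.
  apply: le_trans (markov_inequality fi _ _); last 2 first.
  - by move=> x; exact: powR_ge0.
  - exact: powR_gt0.
  apply: pr_le.
  - by apply: measurable_strict_superlevel; exact: measurableT_comp.
  - by apply: measurable_superlevel; exact: integrable_measurableR fi.
  - move=> x /= h; apply: ge0_ler_powR; rewrite ?nnegrE//; exact: ltW.
have lower : s `^ q * (j ^ (B.+1 * n))%:R * j%:R <= (s * j%:R ^+ B) `^ q.
  rewrite (powRM _ (ltW s0) (exprn_ge0 _ (ltW j0))) -mulrA ler_pM2l//.
  rewrite -(powR_mulrn B (ltW j0)) -powRrM natrX -exprSr.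
  have -> : (B.+1 * n).+1 = (B * n + n.+1)%N by rewrite mulSn addnS addnC.
  by rewrite -(powR_mulrn _ (ltW j0)); apply: ler_powR => //; rewrite ler1n.
set N := (j ^ (B.+1 * n))%:R in lower *.
have N0 : 0 < N by rewrite ltr0n expn_gt0 j1.
apply: le_trans (ler_wpM2l (ltW N0) tail) _.
rewrite mulrA ler_pdivrMr ?powR_gt0//.
apply: (@le_trans _ _ (eps * (s `^ q * N * j%:R))); last by rewrite ler_pM2l.
have : m <= eps * s `^ q * j%:R.
  rewrite -ler_pdivrMl ?mulr_gt0//.
  apply: ltW; apply: le_lt_trans (lt_le_trans (truncnS_gt _) _); last first.
    by rewrite ler_nat; exact: jj.
  by rewrite le_eqVlt; apply/orP; left; apply/eqP; field; rewrite !gt_eqF.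
move=> /(ler_wpM2l (ltW N0)) /le_trans; apply.
by rewrite le_eqVlt; apply/orP; left; apply/eqP; ring.
Qed.

End tails.

(** * A Chernoff bound for truncated sums along a progression *)

Section exponential_bound.
Context (R : realType) (d : nat) (G : ptopologicalType).
Context (P : probability (environment d G) R).
Hypothesis P_iid : iid_product P.
Local Notation Omega := (environment d G).

Lemma expR_le1D2x (x : R) : 0 <= x <= 2^-1 -> expR x <= 1 + 2 * x.
Proof.
move=> /andP[x0 x1]; have := expR_ge1Dx (- x); rewrite expRN => e.
have x2 : 0 < 1 + - x by lra.
have : expR x <= (1 + - x)^-1 by rewrite -[expR x]invrK lef_pV2 ?posrE// ?invr_gt0 ?expR_gt0.
move=> /le_trans; apply; rewrite -[leLHS]mul1r ler_pdivrMr//; nra.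
Qed.

(** Spacing [l] makes the summands independent. At exponential parameter [1 / (2 t)] each factor has
    mean at most [exp (mu / t)], and the threshold [2 mu + 2] per term leaves exactly
    [exp (- m / t)]. *)
Lemma chernoff (L : {fset site d}) (Y : Omega -> R) (z a : site d) (l : nat) :
  P.-integrable setT (EFin \o Y) -> (forall w, 0 <= Y w) -> depends_on (mem L) Y ->
  (0 < l)%N ->
  (forall j x y, (l <= j)%N -> x \in L -> y \in L -> x <> y + z *+ j) ->
  forall (t : R) m, 0 < t ->
  pr P [set w | (2 * (\int[P]_w Y w) + 2) * m%:R <=
         \sum_(j < m) Num.min (Y (env_shift (a + z *+ (l * j)) w)) t] <=
  expR (- (m%:R / t)).
Proof.
move=> Yi Y0 YL l0 lL t m t0.
have mY := integrable_measurableR Yi.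
set mu := \int[P]_w Y w.
have mu0 : 0 <= mu by apply: Rintegral_ge0 => w _; exact: Y0.
(* The factor [1 / (2 t)] keeps the exponent within [[0, 1/2]], where [exp x <= 1 + 2 x]. *)
pose phi w := expR (Num.min (Y w) t / (2 * t)).
have t2 : 0 < 2 * t by rewrite mulr_gt0.
have mphi : measurable_fun setT phi.
  apply: measurableT_comp => //; apply: measurable_funM => //.
  by apply: measurable_minr.
have min01 w : 0 <= Num.min (Y w) t / (2 * t) <= 2^-1.
  apply/andP; split; first by rewrite divr_ge0 ?(ltW t2)// le_min Y0 ltW.
  by rewrite ler_pdivrMr// mulrA mulVf// mul1r ge_min lexx orbT.
pose e : R := expR 2^-1.
have e1 : 1 <= e by rewrite -expR0 ler_expR invr_ge0.
have phi0 w : 0 <= phi w by exact: expR_ge0.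
have phie w : phi w <= e by rewrite ler_expR; case/andP: (min01 w).
have phin w : `|phi w| <= e by rewrite ger0_norm.
have Ephi : \int[P]_w phi w <= expR (mu / t).
  apply: le_trans (expR_ge1Dx _).
  have -> : 1 + mu / t = \int[P]_w (1 + t^-1 * Y w).
    rewrite RintegralD//; [|exact: integrable_cstR|exact: integrableZR].
    by rewrite Rintegral_cstP RintegralZl// mulrC.
  apply: le_Rintegral => //.
  - exact: prob_bounded_integrable phin.
  - by apply: integrableDR; [exact: integrable_cstR|exact: integrableZR].
  - move=> w _; apply: le_trans (expR_le1D2x (min01 w)) _; rewrite lerD2l.
    have -> : 2 * (Num.min (Y w) t / (2 * t)) = t^-1 * Num.min (Y w) t.
      by field; rewrite gt_eqF.
    by rewrite ler_pM2l ?invr_gt0// ge_min lexx.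
have phiL : depends_on (mem L) phi by move=> w w' /YL h; rewrite /phi h.
pose p_ j w := phi (env_shift (a + z *+ (l * j)) w).
pose Phi m w := \prod_(j < m) p_ j w.
have mPhi k : measurable_fun setT (Phi k).
  by apply: measurable_prod => j _; exact: measurable_shifted.
have PhiS k : Phi k.+1 = (fun w => Phi k w * p_ k w).
  by apply/funext => w; rewrite /Phi big_ord_recr.
have Phi0 k w : 0 <= Phi k w by apply: prodr_ge0 => j _; exact: phi0.
have Phie k w : Phi k w <= e ^+ k.
  elim: k => [|k IH]; first by rewrite /Phi big_ord0 expr0.
  by rewrite PhiS exprSr; apply: ler_pM => //; [exact: phi0|exact: phie].
(* One power to spare, so that the same constant also bounds the next factor [p_ k] when
   [independence] is applied. *)
have Phin k w : `|Phi k w| <= e ^+ k.+1.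
  rewrite ger0_norm//; apply: le_trans (Phie k w) _.
  by rewrite exprSr ler_peMr// exprn_ge0// (le_trans ler01).
have EPhi k : \int[P]_w Phi k w <= expR (k%:R * (mu / t)).
  elim: k => [|k IH].
    rewrite mul0r expR0 /Phi; under eq_Rintegral do rewrite big_ord0.
    by rewrite Rintegral_cstP.
  rewrite PhiS (@independence _ _ _ _ P_iid
    [pred x | has (fun j => x - (a + z *+ (l * j)) \in L) (iota 0 k)]
    [pred x | x - (a + z *+ (l * k)) \in L] (e ^+ k.+1))//=.
  - rewrite -natr1 mulrDl mul1r expRD; apply: ler_pM => //.
    + by apply: Rintegral_ge0.
    + by apply: Rintegral_ge0 => w _; exact: phi0.
    + rewrite [leLHS](Rintegral_shift P_iid (a + z *+ (l * k)) (f := phi))//.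
      exact: prob_bounded_integrable phin.
  - move=> x; rewrite !inE => /hasP[j]; rewrite mem_iota add0n => /andP[_ jk] xj.
    apply/negP => xk; have := lL (l * (k - j))%N _ _ _ xj xk; apply.
      by rewrite leq_pmulr// subn_gt0.
    rewrite mulnBr mulrnBr; last by rewrite leq_mul2l (ltnW jk) orbT.
    by rewrite !opprD !addrA subrK.
  - move=> w w' ww'; apply: eq_bigr => j _; apply: phiL => x xL; apply: ww'.
    rewrite inE; apply/hasP; exists (j : nat).
      by rewrite mem_iota add0n ltn_ord.
    by rewrite addrC addKr.
  - exact: (@depends_on_shift _ _ (mem L) R phi (a + z *+ (l * k)) phiL).
  - exact: measurable_shifted.
  - move=> w; apply: le_trans (phin _) _.
    by rewrite exprS ler_peMr// ?exprn_ege1// (le_trans ler01).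
have Phii k : P.-integrable setT (EFin \o Phi k) by exact: prob_bounded_integrable (Phin k).
have PhiE k w : Phi k w = expR ((\sum_(j < k)
    Num.min (Y (env_shift (a + z *+ (l * j)) w)) t) / (2 * t)).
  by rewrite mulr_suml expR_sum.
pose c := expR ((2 * mu + 2) * m%:R / (2 * t)).
have -> : [set w | (2 * mu + 2) * m%:R <=
    \sum_(j < m) Num.min (Y (env_shift (a + z *+ (l * j)) w)) t] = [set w | c <= Phi m w].
  by apply/seteqP; split=> w /=; rewrite PhiE ler_expR ler_pM2r ?invr_gt0.
apply: le_trans (markov_inequality (Phii m) (Phi0 m) (expR_gt0 _)) _.
rewrite ler_pdivrMr ?expR_gt0// -expRD; apply: le_trans (EPhi m) _.
rewrite ler_expR le_eqVlt; apply/orP; left; apply/eqP.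
by field; rewrite gt_eqF.
Qed.

End exponential_bound.

(** * Cocycles along paths *)

Section lattice_geometry.
Context (d : nat).
Implicit Types x y z : site d.

Definition in_cube (r : nat) x := forall i, `|x ord0 i| <= r%:Z.

Lemma in_cubeW r r' x : (r <= r')%N -> in_cube r x -> in_cube r' x.
Proof. by move=> rr' xr i; apply: le_trans (xr i) _; rewrite lez_nat. Qed.

Lemma in_cube0 r : in_cube r 0.
Proof. by move=> i; rewrite mxE normr0. Qed.

Lemma in_cubeD r r' x y : in_cube r x -> in_cube r' y -> in_cube (r + r') (x + y).
Proof.
move=> xr yr i; rewrite mxE PoszD; apply: le_trans (ler_normD _ _) _.
exact: lerD.
Qed.

Lemma in_cubeMn r z j k : (j <= k)%N -> in_cube r z -> in_cube (k * r) (z *+ j).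
Proof.
move=> jk zr; apply: (@in_cubeW (j * r)); first by rewrite leq_mul2r jk orbT.
elim: j {jk} => [|j IH]; first by rewrite mulr0n; exact: in_cube0.
by rewrite mulrS mulSn; exact: in_cubeD.
Qed.

(** The sites of the cube parametrised by a finite type, for union bounds and for counting. *)
Definition cube_site (r : nat) (f : {ffun 'I_d -> 'I_(2 * r).+1}) : site d :=
  \row_i ((f i : nat)%:Z - r%:Z).

Lemma in_cube_site r x : in_cube r x -> exists f, x = @cube_site r f.
Proof.
move=> xr; exists [ffun i => inord (absz (x ord0 i + r%:Z))].
apply/rowP => i; rewrite mxE ffunE.
have := xr i; rewrite ler_norml => /andP[h1 h2].
rewrite inordK; last by lia.
have -> : x 0 i = x ord0 i by congr (x _ _); exact/val_inj.
by rewrite gez0_abs; lia.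
Qed.

Lemma steps_cube (steps : {fset site d}) :
  exists r, forall z, z \in steps -> in_cube r z.
Proof.
exists (\sum_(z <- steps) \sum_i `|z ord0 i|)%N => z zs i.
rewrite (big_rem z)//= (bigD1 i)//= -abszE lez_nat -addnA.
exact: leq_addr.
Qed.

End lattice_geometry.

(** * Deterministic estimates in one fixed environment *)

Section cocycle_paths.
Context (R : realType) (d : nat) (steps : {fset site d}).
Context (B : site d -> site d -> R) (Y : site d -> R).
Hypothesis B_cocycle : forall x y z, B x y + B y z = B x z.
Hypothesis Y_ge0 : forall x, 0 <= Y x.
Hypothesis B_le : forall x z, z \in steps -> B x (x + z) <= Y x.

Lemma cocycle_diag x : B x x = 0.
Proof. by have := B_cocycle x x x; lra. Qed.

Lemma cocycle_line x z c : z \in steps ->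
  B x (x + z *+ c) <= \sum_(i < c) Y (x + z *+ i).
Proof.
move=> zs; elim: c => [|c IH]; first by rewrite mulr0n addr0 big_ord0 cocycle_diag.
rewrite big_ord_recr/= -(B_cocycle x (x + z *+ c)); apply: lerD => //.
by rewrite mulrSr addrA; exact: B_le.
Qed.

(** The displacement is made one direction at a time. Each straight segment moves at most [k * S0]
    in any coordinate, so all segments start in the enlarged cube where [C] applies. *)
Lemma cocycle_staircase (S0 k : nat) (C : R) (s : seq (site d)) (c : site d -> nat) x r :
  {subset s <= steps} -> (forall z, z \in steps -> in_cube S0 z) ->
  (forall z, z \in s -> (c z <= k)%N) -> in_cube r x ->
  (forall y z, z \in steps -> in_cube (r + size s * (k * S0)) y ->
     \sum_(i < k) Y (y + z *+ i) <= C) ->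
  B x (x + \sum_(z <- s) z *+ c z) <= (size s)%:R * C.
Proof.
move=> ss S0P; elim: s x r ss => [|z s IH] x r ss ck xr lineC.
  by rewrite big_nil addr0 cocycle_diag mul0r.
have zs : z \in steps by apply: ss; rewrite mem_head.
have czk : (c z <= k)%N by apply: ck; rewrite mem_head.
rewrite big_cons addrA -(B_cocycle x (x + z *+ c z)) /= -natr1 mulrDl mul1r [leRHS]addrC.
apply: lerD; last first.
  apply: (IH _ (r + k * S0)%N).
  - by move=> y ys; apply: ss; rewrite inE ys orbT.
  - by move=> y ys; apply: ck; rewrite inE ys orbT.
  - by apply: in_cubeD => //; apply: in_cubeMn => //; exact: S0P.
  - by move=> y z' z's yr; apply: lineC => //; rewrite /= mulSn addnA.
apply: le_trans (cocycle_line x (c z) zs) _.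
(* Nonnegativity of [Y] lets a shorter segment be prolonged to the full length [k]. *)
apply: (@le_trans _ _ (\sum_(i < k) Y (x + z *+ i))).
  rewrite -!(big_mkord xpredT (fun i => Y (x + z *+ i))).
  rewrite [leRHS](big_cat_nat (leq0n _) czk)//= lerDl.
  by apply: sumr_ge0 => i _; exact: Y_ge0.
by apply: lineC => //; apply: in_cubeW xr; exact: leq_addr.
Qed.

(** [a z] counts the uses of the step [z]; the order of the steps does not affect the endpoint. *)
Lemma admissible_endpoint n (x : nat -> site d) : admissible steps n x ->
  exists2 a : site d -> nat, forall z, (a z <= n)%N &
    x n = \sum_(z <- steps) z *+ a z.
Proof.
move=> [x0]; elim: n => [|n IH] xs.
  by exists (fun=> 0%N) => //; rewrite x0 big1// => z _; rewrite mulr0n.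
have [a an xn] := IH (fun k kn => xs k (leqW kn)).
have := xs n (ltnSn n); set z0 := x n.+1 - x n => ss.
exists (fun z => a z + (z == z0))%N.
  by move=> z; have := an z; case: (z == z0); lia.
have -> : x n.+1 = x n + z0 by rewrite /z0 addrC subrK.
under eq_bigr do rewrite mulrnDr.
rewrite big_split/= -xn; congr (_ + _); clearbody z0.
rewrite (bigD1_seq z0 ss (fset_uniq _)) eqxx mulr1n big1 => [|z /negPf ->]; last by rewrite mulr0n.
exact/esym/addr0.
Qed.

Lemma admissible_in_cube n (x : nat -> site d) S0 : admissible steps n x ->
  (forall z, z \in steps -> in_cube S0 z) -> in_cube (n * S0) (x n).
Proof.
move=> [x0 xs] S0P; elim: n xs => [|n IH] xs; first by rewrite x0; exact: in_cube0.
have -> : x n.+1 = (x n.+1 - x n) + x n by rewrite subrK.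
rewrite mulSn; apply: in_cubeD; first exact/S0P/xs.
by apply: IH => k kn; apply: xs; exact: leqW.
Qed.

Definition coarse_site (D k : nat) (b : {ffun steps -> 'I_D.+1}) : site d :=
  \sum_(z : steps) val z *+ (b z * k).

(* Round the step counts of the path up to multiples of [k]: this leaves only
   [(D.+1) ^ #|steps|] possible targets, each reached by a short staircase. *)
Lemma endpoint_bound (D k S0 : nat) (x : nat -> site d) (C E : R) : (0 < k)%N ->
  admissible steps (D * k) x -> (forall z, z \in steps -> in_cube S0 z) ->
  (forall y z, z \in steps ->
     in_cube ((D * k) * S0 + size steps * (k * S0)) y ->
     \sum_(i < k) Y (y + z *+ i) <= C) ->
  (forall b : {ffun steps -> 'I_D.+1}, - E <= B 0 (coarse_site k b)) ->
  - B 0 (x (D * k)%N) <= E + (size steps)%:R * C.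
Proof.
move=> k0 xadm S0P lineC coarse.
have [a an xn] := admissible_endpoint xadm.
(* The ceiling of [a z / k]: rounding up puts the coarse site ahead of the endpoint, where upper
   bounds on [B] along steps apply. *)
pose q z := ((a z + k.-1) %/ k)%N.
have qD z : (q z <= D)%N.
  rewrite /q -ltnS ltn_divLR// mulSn.
  by have := an z; lia.
have aq z : (a z <= q z * k)%N.
  have := divn_eq (a z + k.-1) k; have := ltn_pmod (a z + k.-1) k0.
  by rewrite -/(q z); lia.
have qk z : (q z * k - a z <= k)%N.
  have := leq_trunc_div (a z + k.-1) k; rewrite -/(q z); lia.
pose b : {ffun steps -> 'I_D.+1} := [ffun z => inord (q (val z))].
have yE : coarse_site k b = x (D * k)%N + \sum_(z <- steps) z *+ (q z * k - a z).
  rewrite xn -big_split/= /coarse_site big_seq_fsetE/=.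
  apply: eq_bigr => z _; rewrite ffunE inordK ?ltnS//.
  by rewrite -mulrnDr subnKC.
have := coarse b; rewrite yE.
rewrite -(B_cocycle 0 (x (D * k)%N)).
have := @cocycle_staircase S0 k C steps (fun z => q z * k - a z)%N (x (D * k)%N)
  (D * k * S0)%N (fun z zs => zs) S0P (fun z _ => qk z)
  (admissible_in_cube xadm S0P) lineC.
by lra.
Qed.

End cocycle_paths.

(** * Centred cocycles at coarse sites *)

Section lower_bound.
Context (R : realType) (d : nat) (G : ptopologicalType).
Context (P : probability (environment d G) R).
Hypothesis P_iid : iid_product P.
Local Notation Omega := (environment d G).

Lemma ae_eq_Rintegral (f g : Omega -> R) : P.-integrable setT (EFin \o f) ->
  P.-integrable setT (EFin \o g) -> {ae P, forall w, f w = g w} ->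
  \int[P]_w f w = \int[P]_w g w.
Proof.
move=> fi gi fg; congr fine; apply: ae_eq_integral => //.
- by apply/measurable_EFinP; exact: integrable_measurableR fi.
- by apply/measurable_EFinP; exact: integrable_measurableR gi.
- by apply: filterS fg => w e _; rewrite /= e.
Qed.

Section centered_cocycle.
Context (F : Omega -> site d -> site d -> R).
Hypothesis FK0 : centered_cocycles P F.

Lemma centered_integrable x y : P.-integrable setT (EFin \o (fun w => F w x y)).
Proof.
have [[[mF _] iF] _] := FK0; apply/integrableP; split.
  by apply/measurable_EFinP; exact: mF.
by have := iF x y; rewrite unlock.
Qed.

Lemma centered_mean x y : \int[P]_w F w x y = 0.
Proof.
by have [_ /(_ x y)] := FK0; rewrite unlock /Rintegral => ->.
Qed.

Lemma centered_ae : {ae P, forall w, forall x y z,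
  F w (x + z) (y + z) = F (env_shift z w) x y /\ F w x y + F w y z = F w x z}.
Proof. by have [[[_ aF] _] _] := FK0. Qed.

Let nF x := \int[P]_w `|F w 0 x|.

Let integrable_nF x y : P.-integrable setT (EFin \o (fun w => `|F w x y|)).
Proof. by apply: integrable_normR; exact: centered_integrable. Qed.

Let nF0 : nF 0 = 0.
Proof.
rewrite /nF -[RHS](Rintegral_cstP P 0); apply: ae_eq_Rintegral => //.
  exact: integrable_cstR.
apply: filterS centered_ae => w /(_ 0 0 0)[_ e]; apply/eqP; rewrite normr_eq0.
by apply/eqP; lra.
Qed.

(** The cocycle relation splits at [x], and shift invariance brings the second piece back to the
    origin. *)
Let nFD x y : nF (x + y) <= nF x + nF y.
Proof.
have iy := integrable_shift P_iid x (integrable_nF 0 y).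
have -> : nF y = \int[P]_w `|F (env_shift x w) 0 y|.
  by rewrite (Rintegral_shift P_iid x (integrable_nF 0 y)).
rewrite {2}/nF -(RintegralD measurableT (integrable_nF 0 x) iy).
have ixy : P.-integrable setT (EFin \o (fun w => `|F w 0 x + F (env_shift x w) 0 y|)).
  apply: integrable_normR; apply: integrableDR; first exact: centered_integrable.
  exact: (integrable_shift P_iid x (centered_integrable 0 y)).
rewrite /nF (@ae_eq_Rintegral _ (fun w => `|F w 0 x + F (env_shift x w) 0 y|))//.
  apply: le_Rintegral => //; first by apply: integrableDR => //; exact: integrable_nF.
  by move=> w _; exact: ler_normD.
apply: filterS centered_ae => w cw.
have [e _] := cw 0 y x; have [_ e'] := cw 0 x (x + y).
by rewrite -e' -e add0r [y + x]addrC.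
Qed.

(** Along a line the cocycle is the orbit sum of its first increment, which has mean zero. *)
Lemma centered_line z : z != 0 -> forall eps : R, 0 < eps ->
  exists K, forall k, (K <= k)%N -> \int[P]_w `|F w 0 (z *+ k)| <= eps * k%:R.
Proof.
move=> z0 eps eps0.
have [K KP] := wlln_integrable P_iid z0 (centered_integrable 0 z) eps0.
exists K => k /KP; rewrite centered_mean mulr0; apply: le_trans.
rewrite le_eqVlt; apply/orP; left; apply/eqP; apply: ae_eq_Rintegral => //.
  exact: (integrable_orbit_dev P_iid _ _ _ (centered_integrable 0 z)).
apply: filterS centered_ae => w cw; rewrite subr0; congr (`|_|).
have line j : F w 0 (z *+ j) = orbit_sum z (fun w => F w 0 z) j w.
  elim: j => [|j IH].
    by rewrite mulr0n /orbit_sum big_ord0; have [_ e] := cw 0 0 0; lra.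
  rewrite orbit_sumS -IH.
  have [e _] := cw 0 z (z *+ j); have [_ e'] := cw 0 (z *+ j) (z *+ j.+1).
  by rewrite -e' -e add0r -mulrS.
exact: line.
Qed.

Lemma centered_coarse (steps : {fset site d}) D (b : {ffun steps -> 'I_D.+1}) :
  (forall z, z \in steps -> z != 0) -> forall eps : R, 0 < eps ->
  exists K, forall k, (K <= k)%N ->
    \int[P]_w `|F w 0 (coarse_site k b)| <= eps * k%:R.
Proof.
move=> steps0; rewrite /coarse_site.
elim: (index_enum _) => [|z s IH] eps eps0.
  exists 0%N => k _; rewrite big_nil -/(nF 0) nF0 mulr_ge0// ltW//.
have e2 : 0 < eps / 2 by rewrite divr_gt0.
have [K KP] := IH _ e2.
have b1 : 0 < (b z)%:R + 1 :> R by rewrite ltr_wpDl.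
(* The segment has length [b z * k], so its error is divided by [b z]; the 1 guards against
   [b z = 0]. *)
have e3 : 0 < eps / 2 / ((b z)%:R + 1) by rewrite divr_gt0.
have [K' KP'] := centered_line (steps0 _ (valP z)) e3.
exists (maxn K K') => k; rewrite geq_max => /andP[Kk K'k].
rewrite big_cons -/(nF _); apply: le_trans (nFD _ _) _.
have -> : eps * k%:R = eps / 2 * k%:R + eps / 2 * k%:R by rewrite -mulrDl -splitr.
apply: lerD; last exact: KP.
have [->|bz] := posnP (b z); first by rewrite mul0n mulr0n nF0 mulr_ge0// ltW.
apply: le_trans (KP' _ _) _; first by rewrite (leq_trans K'k)// leq_pmull.
rewrite natrM mulrA ler_wpM2r// -mulrA ger_pMr// mulrC ler_pdivrMr// mul1r.
by rewrite lerDl.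
Qed.

End centered_cocycle.

Lemma eventually_bad_absurd (bad : nat -> set Omega) :
  (forall j, measurable (bad j)) ->
  (forall eps : R, 0 < eps -> exists j0, forall j, (j0 <= j)%N -> pr P (bad j) <= eps) ->
  {ae P, forall w, exists j0, forall j, (j0 <= j)%N -> bad j w} -> False.
Proof.
move=> mbad small bad_ae.
have nbad : {ae P, forall w, forall j0, ~ (forall j, (j0 <= j)%N -> bad j w)}.
  apply/ae_foralln => j0.
  have mN : measurable (\bigcap_(j in [set j | (j0 <= j)%N]) bad j).
    by apply: bigcap_measurableType => j _.
  exists (\bigcap_(j in [set j | (j0 <= j)%N]) bad j); split => //.
    apply: etrans (esym (prE P mN)) _; congr EFin; apply/eqP; rewrite eq_le pr_ge0 andbT.
    apply/ler_addgt0Pr => eps eps0; rewrite add0r.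
    have [j1 j1P] := small _ eps0.
    apply: le_trans (j1P (maxn j0 j1) (leq_maxr _ _)); apply: pr_le => //.
    by move=> w; apply; rewrite /= leq_maxl.
  by move=> w /= /contrapT h j /= jj; exact: h.
have [N [mN N0 TN]] : {ae P, forall w : Omega, False}.
  by apply: filterS2 bad_ae nbad => w [j0 h] /(_ j0).
have : (P setT <= P N)%E.
  by apply: le_measure; rewrite ?inE// => w _; apply: TN => /=; exact.
by rewrite N0 probability_setT lee_fin ler10.
Qed.

End lower_bound.

(** * The limit is a lower bound *)

(** Sorting by residue modulo [l] yields progressions of spacing [l], as [chernoff] requires. *)
Lemma sum_residues (R : realType) (l m : nat) (f : nat -> R) :
  \sum_(i < l * m) f i = \sum_(i < l) \sum_(q < m) f (i + l * q)%N.
Proof.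
elim: m => [|m IH].
  by rewrite muln0 big_ord0 big1// => i _; rewrite big_ord0.
rewrite mulnSr big_split_ord/= IH -big_split/=; apply: eq_bigr => i _.
by rewrite big_ord_recr/= addnC.
Qed.

Lemma poly_expR_small (R : realType) (M : nat) (A eps : R) : 0 <= A -> 0 < eps ->
  exists j0, forall j : nat, (j0 <= j)%N -> A * (j ^ M)%:R * expR (- j%:R) <= eps.
Proof.
move=> A0 eps0; set f := (M.+1`!)%:R : R.
have f0 : 0 < f by rewrite ltr0n fact_gt0.
exists (Num.truncn (A * f / eps)).+1 => j jj.
have j0 : 0 < j%:R :> R by rewrite ltr0n (leq_ltn_trans _ jj).
have e1 : j%:R ^+ M.+1 / f <= expR j%:R.
  by apply: le_trans (expR_ge1Dxn M (ltW j0)); rewrite lerDr.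
rewrite expRN ler_pdivrMr ?expR_gt0//.
apply: le_trans (ler_wpM2l (ltW eps0) e1).
rewrite natrX exprSr mulrA ler_pdivlMr// mulrA.
rewrite -[leLHS]mulrA [_ * f]mulrC mulrA -[leRHS]mulrA [_ * j%:R]mulrC mulrA.
rewrite ler_wpM2r ?exprn_ge0// ?(ltW j0)// -ler_pdivrMl// mulrC ltW//.
by apply: lt_le_trans (truncnS_gt _) _; rewrite ler_nat.
Qed.

Section ergodic_lower_bound.
Context (R : realType) (d : nat) (G : ptopologicalType).
Context (P : probability (environment d G) R).
Hypothesis P_iid : iid_product P.
Local Notation Omega := (environment d G).
Context (steps : {fset site d}) (V : Omega -> site d -> R) (h : 'rV[R]_d).
Hypothesis steps_neq0 : steps != fset0.
Hypothesis step_neq0 : forall z, z \in steps -> z != 0.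
Hypothesis V_integrable :
  forall z, z \in steps -> P.-integrable setT (EFin \o (V ^~ z)).
Hypothesis V_local : forall z, z \in steps -> local_fun (V ^~ z).
Hypothesis V_tail : forall z, z \in steps -> thin_tail P d (fun w => `|V w z|).
Context (g : R).
Hypothesis g_limit : {ae P, forall w,
  n%:R^-1 * point_to_level steps V h n w @[n --> \oo] --> g}.
Context (F : Omega -> site d -> site d -> R) (c : R).
Hypothesis FK0 : centered_cocycles P F.
Hypothesis F_le : {ae P, forall w, forall z, z \in steps ->
  V w z + dot h z + F w 0 z <= c}.

(** An upper bound for the cocycle on every step which, unlike the cocycle, inherits locality and
    thin tails from [V]. *)
Let Y (w : Omega) : R :=
  \sum_(z : steps) `|V w (val z)| + (\sum_(z : steps) `|dot h (val z)| + `|c|).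

Let Y_ge0 w : 0 <= Y w.
Proof. by rewrite !addr_ge0 ?sumr_ge0. Qed.

Let V_abs_integrable (z : steps) : P.-integrable setT (EFin \o (fun w => `|V w (val z)|)).
Proof. by apply: integrable_normR; exact: V_integrable (valP z). Qed.

Let Y_integrable : P.-integrable setT (EFin \o Y).
Proof.
by apply: integrableDR; [exact: integrable_sumR|exact: integrable_cstR].
Qed.

Let Y_tail : thin_tail P d Y.
Proof.
apply: thin_tailD => //.
- exact: integrable_measurableR (integrable_sumR _ V_abs_integrable).
- apply: thin_tail_sum => z; first exact: integrable_measurableR (V_abs_integrable z).
  exact: V_tail (valP z).
- exact: thin_tail_cst.
Qed.

Let Y_local : exists L : {fset site d}, depends_on (mem L) Y.
Proof.
have [L YL] : exists L : {fset site d},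
    depends_on (mem L) (fun w => \sum_(z : steps) `|V w (val z)|).
  elim: (index_enum _) => [|z s [L IH]].
    by exists fset0 => w w' _; rewrite !big_nil.
  have [L' VL'] := V_local (valP z).
  exists (L `|` L')%fset => w w' ww'; rewrite !big_cons; congr (`|_| + _).
    by apply: VL' => x xL'; apply: ww'; rewrite /= inE xL' orbT.
  by apply: IH => x xL; apply: ww'; rewrite /= inE; apply/orP; left.
by exists L => w w' ww'; rewrite /Y (YL _ _ ww').
Qed.

Let F_le_Y w z : z \in steps -> V w z + dot h z + F w 0 z <= c -> F w 0 z <= Y w.
Proof.
move=> zs h1.
have a1 : `|V w z| <= \sum_(z : steps) `|V w (val z)|.
  by rewrite (bigD1 [`zs]%fset)//= lerDl sumr_ge0.
have a2 : `|dot h z| <= \sum_(z : steps) `|dot h (val z)|.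
  by rewrite (bigD1 [`zs]%fset)//= lerDl sumr_ge0.
have := ler_norm c; have := ler_norm (- V w z); have := ler_norm (- dot h z).
by rewrite !normrN /Y; move: a1 a2 h1; lra.
Qed.

Let path_value_le w n x :
  (forall x y z, F w (x + z) (y + z) = F (env_shift z w) x y /\
     F w x y + F w y z = F w x z) ->
  (forall x z, z \in steps ->
     V (env_shift x w) z + dot h z + F (env_shift x w) 0 z <= c) ->
  admissible steps n x -> path_value V h n w x <= n%:R * c - F w 0 (x n).
Proof.
move=> Fw Fle [x0 xs]; rewrite /path_value.
elim: n xs => [|n IH] xs.
  by rewrite big_ord0 x0 dot0 mul0r; have [_] := Fw 0 0 0; lra.
have zs := xs n (ltnSn n); have := Fle (x n) _ zs.
have [e _] := Fw 0 (x n.+1 - x n) (x n); rewrite -e add0r subrK.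
have [_] := Fw 0 (x n) (x n.+1).
have := IH (fun k kn => xs k (leqW kn)).
have -> : dot h (x n.+1) = dot h (x n) + dot h (x n.+1 - x n).
  by rewrite -dotD addrC subrK.
rewrite big_ord_recr/= -[n.+1%:R]natr1 mulrDl mul1r; lra.
Qed.

(** Suppose [c < g]. Off [bad j] every path of length [n j] has value at most [n j * (c + eta)],
    below what the limit [g] demands for large [j]; so [bad j] occurs eventually, although its
    probability vanishes. *)
Lemma limit_le_cocycle_bound : g <= c.
Proof.
rewrite leNgt; apply/negP => cg.
pose eta := (g - c) / 2.
have eta0 : 0 < eta by rewrite divr_gt0// subr_gt0.
have [S0 S0P] := steps_cube steps.
have [L YL] := Y_local.
have [l l0 lP] : exists2 l, (0 < l)%N & forall z, z \in steps ->
    forall j x y, (l <= j)%N -> x \in L -> y \in L -> x <> y + z *+ j.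
  have /choice[l_ l_P] : forall z : steps, exists l, forall j x y,
      (l <= j)%N -> x \in L -> y \in L -> x <> y + val z *+ j.
    by move=> z; have [l _ lz] := separating_multiple L (step_neq0 (valP z)); exists l.
  exists (\max_z l_ z).+1 => // z zs j x y lj.
  apply: (l_P [`zs]%fset); apply: leq_trans lj; apply: leqW.
  exact: (leq_bigmax [`zs]%fset).
set mu := \int[P]_w Y w.
have mu0 : 0 <= mu by apply: Rintegral_ge0 => w _; exact: Y_ge0.
pose r := size (enum_fset steps).
(* The coarse error [k] and the [r] segments at cost [(2 mu + 2) k] each must fit into [eta * n]
   with [n = D * k]. *)
pose D := (Num.truncn ((1 + r%:R * (2 * mu + 2)) / eta)).+1.
have DP : 1 + r%:R * (2 * mu + 2) <= D%:R * eta.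
  by rewrite -ler_pdivrMr//; apply: ltW; exact: truncnS_gt.
have [B BP] := Y_tail.
have {BP} YB := BP B (leqnn B) 1.
(* A segment of [k j] sites splits into [l] progressions of [m j] sites; with truncation at [t j]
   the Chernoff exponent [m j / t j] equals [j]. *)
pose m j := (j ^ B.+1)%N.
pose k j := (l * m j)%N.
pose n j := (D * k j)%N.
(* Room for the path, for the staircase, and for one further segment. *)
pose rad j := (n j * S0 + r * (k j * S0) + k j * S0)%N.
pose kap := (D * l * S0 + r * (l * S0) + l * S0)%N.
have radE j : rad j = (kap * m j)%N by rewrite /rad /kap /n /k; lia.
pose t j : R := 1 * j%:R ^+ B.
(* The three ways to fail: a value of [Y] above the truncation level, a large truncated sum along a
   progression, a large cocycle value at a coarse site. *)
pose A1 j := [set w | exists u : {ffun 'I_d -> 'I_(2 * rad j).+1},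
  t j < Y (env_shift (cube_site u) w)].
pose A2 j := [set w | exists p : {ffun 'I_d -> 'I_(2 * rad j).+1} * steps,
  (2 * mu + 2) * (m j)%:R <= \sum_(i < m j)
     Num.min (Y (env_shift (cube_site p.1 + val p.2 *+ (l * i)) w)) (t j)].
pose A3 j := [set w | exists b : {ffun steps -> 'I_D.+1},
  (k j)%:R <= `|F w 0 (coarse_site (k j) b)|].
pose bad j := A1 j `|` (A2 j `|` A3 j).
have mY := integrable_measurableR Y_integrable.
have [mA1 pA1] : (forall j, measurable (A1 j)) /\ (forall j,
    pr P (A1 j) <= #|{ffun 'I_d -> 'I_(2 * rad j).+1}|%:R * pr P [set w | t j < Y w]).
  split=> j; have [] // := @exists_union _ _ _ P _
    (fun u : {ffun 'I_d -> 'I_(2 * rad j).+1} =>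
      [set w | t j < Y (env_shift (cube_site u) w)]) (pr P [set w | t j < Y w]);
    by [move=> u; apply: measurable_strict_superlevel; exact: measurable_shifted
       |move=> u; rewrite le_eqVlt; apply/orP; left; apply/eqP; congr fine;
        exact: (env_shift_preserving P_iid (cube_site u)
          (measurable_strict_superlevel (t j) mY))].
have t0 j : (0 < j)%N -> 0 < t j.
  by move=> j0; rewrite /t mul1r exprn_gt0// ltr0n.
have mA2i j (p : {ffun 'I_d -> 'I_(2 * rad j).+1} * steps) :
    measurable [set w | (2 * mu + 2) * (m j)%:R <= \sum_(i < m j)
     Num.min (Y (env_shift (cube_site p.1 + val p.2 *+ (l * i)) w)) (t j)].
  apply: measurable_superlevel; apply: measurable_sum => i.
  by apply: measurable_minr => //; exact: measurable_shifted.
have [mA2 pA2] : (forall j, measurable (A2 j)) /\ (forall j, (0 < j)%N -> pr P (A2 j) <=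
    #|{: {ffun 'I_d -> 'I_(2 * rad j).+1} * steps}|%:R * expR (- j%:R)).
  split=> j => [|j0].
    by have [] // := @exists_union _ _ _ P _ _ 1 (mA2i j) => u; rewrite -lee_fin prE// probability_le1.
  have [] // := @exists_union _ _ _ P _ _ (expR (- j%:R)) (mA2i j).
  move=> p; have mt : (m j)%:R / t j = j%:R.
    by rewrite /m /t mul1r natrX exprS mulfK// expf_neq0// pnatr_eq0 -lt0n.
  rewrite -{}mt.
  exact: (chernoff P_iid (cube_site p.1) Y_integrable Y_ge0 YL l0 (lP _ (valP p.2))
    (m j) (t0 _ j0)).
have mF x y : measurable_fun setT (fun w => `|F w x y|).
  by apply: measurableT_comp => //; exact: integrable_measurableR (centered_integrable FK0 x y).
have mA3i j (b : {ffun steps -> 'I_D.+1}) :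
    measurable [set w | (k j)%:R <= `|F w 0 (coarse_site (k j) b)|].
  by apply: measurable_superlevel; exact: mF.
have mA3 j : measurable (A3 j).
  by have [] // := @exists_union _ _ _ P _ _ 1 (mA3i j) => u; rewrite -lee_fin prE// probability_le1.
have mbad j : measurable (bad j) by apply: measurableU => //; exact: measurableU.
have k_ge j : (0 < j)%N -> (j <= k j)%N.
  move=> j0; rewrite /k /m expnS mulnCA leq_pmulr// muln_gt0 l0/=.
  by rewrite expn_gt0 j0.
have n_ge j : (0 < j)%N -> (j <= n j)%N.
  by move=> j0; apply: leq_trans (k_ge _ j0) _; rewrite /n leq_pmull.
pose CC := ((2 * kap).+1 ^ d)%N.
have cardE j : (0 < j)%N -> (#|{ffun 'I_d -> 'I_(2 * rad j).+1}| <= CC * j ^ (B.+1 * d))%N.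
  have expW a b e : (a <= b)%N -> (a ^ e <= b ^ e)%N by case: e => // e; rewrite leq_exp2r.
  move=> j0; rewrite card_ffun !card_ord expnM -/(m j) -expnMn; apply: expW.
  have m0 : (0 < m j)%N by rewrite expn_gt0 j0.
  by rewrite radE mulnA mulSn -[X in (X < _)%N]add0n ltn_add2r.
apply: (@eventually_bad_absurd _ _ _ P bad mbad) => [eps eps0|].
  have e3 : 0 < eps / 3 by rewrite divr_gt0.
  have CC0 : 0 < CC%:R :> R by rewrite ltr0n expn_gt0.
  have [j1 j1P] := YB (eps / 3 / CC%:R) ltr01 (divr_gt0 e3 CC0).
  have [j2 j2P] := @poly_expR_small R (B.+1 * d) (CC%:R * #|{: steps}|%:R) (eps / 3)
    (mulr_ge0 (ler0n _ _) (ler0n _ _)) e3.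
  pose Nb := #|{ffun steps -> 'I_D.+1}|.
  have Nb0 : 0 < Nb%:R + 1 :> R by rewrite ltr_wpDl.
  have /choice[K KP] := fun b => @centered_coarse _ _ _ _ P_iid _ FK0 steps D b
    step_neq0 _ (divr_gt0 e3 Nb0).
  pose j3 := \max_b K b.
  exists (maxn 1 (maxn j1 (maxn j2 j3))) => j; rewrite !geq_max => /and4P[j0 jj1 jj2 jj3].
  have p1 : pr P (A1 j) <= eps / 3.
    apply: le_trans (pA1 j) _.
    apply: le_trans (ler_wpM2r (pr_ge0 _ _) (_ : _ <= (CC * j ^ (B.+1 * d))%:R)) _.
      by rewrite ler_nat; exact: cardE.
    by rewrite natrM -mulrA mulrC -ler_pdivlMr//; exact: j1P.
  have p2 : pr P (A2 j) <= eps / 3.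
    apply: le_trans (pA2 j j0) _; apply: le_trans (j2P j jj2).
    rewrite ler_wpM2r ?expR_ge0// card_prod natrM mulrAC ler_wpM2r//.
    by rewrite -natrM ler_nat; exact: cardE.
  have k0 : 0 < (k j)%:R :> R by rewrite ltr0n (leq_trans j0) ?k_ge.
  have p3 : pr P (A3 j) <= eps / 3.
    have bound (b : {ffun steps -> 'I_D.+1}) : pr P [set w | (k j)%:R <= `|F w 0 (coarse_site (k j) b)|] <=
        eps / 3 / (Nb%:R + 1).
      apply: le_trans (markov_inequality _ _ k0) _ => //.
        by apply: integrable_normR; exact: centered_integrable.
      rewrite ler_pdivrMr//; apply: KP.
      apply: leq_trans (k_ge _ j0); apply: leq_trans jj3; exact: leq_bigmax.
    have [_ le3] := exists_union (mA3i j) bound.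
    apply: le_trans le3 _; rewrite -/Nb mulrA ler_pdivrMr// mulrC ler_pM2l//.
    by rewrite lerDl.
  apply: le_trans (prU _ _ _) _ => //; first exact: measurableU.
  have := @prU _ _ _ P _ _ (mA2 j) (mA3 j); move: p1 p2 p3; lra.
have cFw := centered_ae FK0.
have Fles := ae_shift P_iid F_le.
move: cFw Fles g_limit; apply: filterS3 => w Fw Fle gw.
have [n0 _ n0P] : \forall q \near \oo, c + eta < q%:R^-1 * point_to_level steps V h q w.
  by apply: (cvgr_gt _ gw); rewrite /eta; move: cg; lra.
exists (maxn 1 n0) => j; rewrite geq_max => /andP[j0 n0j].
apply: contrapT => /not_orP[nA1 /not_orP[nA2 nA3]].
have nj0 : 0 < (n j)%:R :> R by rewrite ltr0n (leq_trans j0) ?n_ge.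
have := n0P (n j) (leq_trans n0j (n_ge _ j0)).
rewrite /= ltNge => /negP; apply; rewrite mulrC ler_pdivrMr//.
have [x xadm [<- _]] := point_to_level_max V h (n j) w steps_neq0.
apply: le_trans (path_value_le Fw Fle xadm) _.
have Ycube u : in_cube (rad j) u -> Y (env_shift u w) <= t j.
  move=> /in_cube_site[f ->]; rewrite leNgt; apply/negP => tY; apply: nA1.
  by exists f.
have line y z : z \in steps -> in_cube (n j * S0 + r * (k j * S0)) y ->
    \sum_(i < k j) Y (env_shift (y + z *+ i) w) <= (2 * mu + 2) * (k j)%:R.
  move=> zs yc.
  have ycube i : (i <= k j)%N -> in_cube (rad j) (y + z *+ i).
    by move=> ik; apply: in_cubeD => //; apply: in_cubeMn => //; exact: S0P.
  rewrite /k (sum_residues l (m j) (fun i => Y (env_shift (y + z *+ i) w))).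
  apply: (@le_trans _ _ (\sum_(i < l) (2 * mu + 2) * (m j)%:R)); last first.
    by rewrite sumr_const card_ord natrM mulrCA -[leLHS]mulr_natl.
  have m0 : (0 < m j)%N by rewrite expn_gt0 j0.
  apply: ler_sum => i _.
  have [f fE] := in_cube_site (ycube i (ltnW (leq_trans (ltn_ord i) (leq_pmulr l m0)))).
  rewrite leNgt; apply/negP => big; apply: nA2.
  exists (f, [`zs]%fset) => /=; rewrite -fE ltW//.
  (* Off [A1] the truncation changes nothing at the sites involved. *)
  apply: lt_le_trans big _; apply: ler_sum => q _.
  rewrite -addrA -mulrnDr le_min lexx/=; apply: Ycube; apply: ycube.
  have := ltn_ord i; have := ltn_ord q; rewrite /k; nia.
have coarse (b : {ffun steps -> 'I_D.+1}) : - (k j)%:R <= F w 0 (coarse_site (k j) b).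
  have : `|F w 0 (coarse_site (k j) b)| <= (k j)%:R.
    by rewrite leNgt; apply/negP => /ltW big; apply: nA3; exists b.
  by rewrite ler_norml => /andP[].
have Bc x' y' z' : F w x' y' + F w y' z' = F w x' z' by have [_] := Fw x' y' z'.
have Ble x' z' : z' \in steps -> F w x' (x' + z') <= Y (env_shift x' w).
  move=> zs'; have [e _] := Fw 0 z' x'; rewrite add0r in e.
  by rewrite addrC e; apply: F_le_Y => //; exact: Fle.
have k0 : (0 < k j)%N by exact: leq_trans (k_ge _ j0).
have := endpoint_bound Bc (fun x => Y_ge0 _) Ble k0 xadm S0P line coarse.
rewrite -/r => endp.
have : (k j)%:R * (1 + r%:R * (2 * mu + 2)) <= (k j)%:R * (D%:R * eta).
  by rewrite ler_wpM2l.
by move: endp; rewrite /n natrM -/(n j); nra.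
Qed.

End ergodic_lower_bound.

(** * Reduction of the hypotheses and conclusion *)

Lemma finite_norm_Lfun (R : realType) d (T : measurableType d) (P : probability T R)
    (n : nat) (p : \bar R) (f : T -> R) : (0 < n)%N -> measurable_fun setT f ->
  (n%:R%:E < p)%E -> finite_norm P p f ->
  exists q : R, [/\ n%:R < q, 1 <= q & f \in Lfun P q%:E].
Proof.
move=> n0 mf np fp.
have fL : f \in Lfun P p by rewrite inE; apply/andP; split; rewrite inE.
have n1 : 1 <= n%:R :> R by rewrite ler1n.
case: p np fp fL => [q| |] // np _ fL.
  exists q; split => //; rewrite lte_fin in np; exact: le_trans n1 (ltW np).
have q1 : 1 <= n.+1%:R :> R by rewrite ler1n.
exists n.+1%:R; split => //; first by rewrite ltr_nat.
apply: (@Lfun_subset _ _ _ P n.+1%:R%:E +oo%E) fL => //.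
- exact: leey.
- exact: fin_num_measure.
- exact: leey.
Qed.

Lemma Lfun_ge1_integrable (R : realType) d (T : measurableType d) (P : probability T R)
    (q : R) (f : T -> R) : 1 <= q -> f \in Lfun P q%:E -> P.-integrable setT (EFin \o f).
Proof.
move=> q1 fL; apply/Lfun1_integrable.
apply: (@Lfun_subset _ _ _ P 1%E q%:E) fL => //.
exact: fin_num_measure.
Qed.

(** Without steps the generated group would be trivial, while the lattice has a nonzero site in
    positive dimension. *)
Lemma span_steps_neq0 (d : nat) (steps : {fset site d}) : (0 < d)%N ->
  additive_span steps = [set: site d] -> steps != fset0.
Proof.
move=> d0 span; apply/eqP => s0.
have span1 : additive_span steps (const_mx 1) by rewrite span.
have : [set 0] (const_mx 1 : site d).
  apply: (span1 [set 0]); split; last by move=> z; rewrite /= s0.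
  split; first by rewrite inE.
  by move=> x y; rewrite !inE => -> ->; rewrite subr0.
by move=> /rowP /(_ (Ordinal d0)); rewrite !mxE.
Qed.

Lemma steps_neq0 (R : realType) (d : nat) (steps : {fset site d}) :
  ~ co steps (0 : 'rV[R]_d) -> forall z, z \in steps -> z != 0.
Proof.
move=> nco z zs; apply/eqP => z0; apply: nco => A [_ sA]; apply: sA.
exists z => //; rewrite z0.
by apply/rowP => i; rewrite !mxE.
Qed.

Lemma bigmaxe_le (R : realType) (I : eqType) (s : seq I) (f : I -> \bar R) (x : \bar R) :
  (\big[maxe/-oo%E]_(i <- s) f i <= x)%E <-> (forall i, i \in s -> f i <= x)%E.
Proof.
elim: s => [|i s IH]; first by rewrite big_nil leNye; split.
rewrite big_cons ge_max; split.
  move=> /andP[fi /IH fs] j; rewrite inE => /predU1P[->//|]; exact: fs.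
move=> fx; apply/andP; split; first by apply: fx; rewrite mem_head.
by apply/IH => j js; apply: fx; rewrite inE js orbT.
Qed.

Theorem theorem2p10 (R : realType) (d : nat) (G : ptopologicalType)
    (P : probability (environment d G) R) (steps : {fset site d})
    (V : environment d G -> site d -> R) (gpl : 'rV[R]_d -> R)
    (d_gt0 : (0 < d)%N)
    (G_polish : polish R G)
    (P_iid : iid_product P)
    (zero_notin_co : ~ co steps (0 : 'rV[R]_d))
    (steps_span : additive_span steps = [set: site d])
    (V_measurable : forall z, z \in steps -> measurable_fun setT (V ^~ z))
    (V_local : forall z, z \in steps -> local_fun (V ^~ z))
    (V_Lp : forall z, z \in steps ->
       exists2 p : \bar R, (d%:R%:E < p)%E & finite_norm P p (V ^~ z))
    (gpl_limit : forall h, {ae P, forall w,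
       n%:R^-1 * point_to_level steps V h n w @[n --> \oo] --> gpl h}) :
  forall h : 'rV[R]_d,
    (gpl h)%:E = ereal_inf (cocycle_esssup P steps V h @` centered_cocycles P)
    /\
    exists2 F, centered_cocycles P F &
      forall F', centered_cocycles P F' ->
        (cocycle_esssup P steps V h F <= cocycle_esssup P steps V h F')%E.
Proof.
move=> h.
have s0 := span_steps_neq0 d_gt0 steps_span.
have z0 := steps_neq0 zero_notin_co.
have VL z : z \in steps -> exists q : R,
    [/\ d%:R < q, 1 <= q & V ^~ z \in Lfun P q%:E].
  by move=> zs; have [p dp fp] := V_Lp z zs;
    exact: finite_norm_Lfun d_gt0 (V_measurable z zs) dp fp.
have Vi z : z \in steps -> P.-integrable setT (EFin \o V ^~ z).
  by move=> /VL[q [_ q1 fq]]; exact: Lfun_ge1_integrable fq.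
have Vt z : z \in steps -> thin_tail P d (fun w => `|V w z|).
  by move=> /VL[q [dq q1 fq]]; exact: thin_tail_Lfun fq.
have lower F : centered_cocycles P F ->
    ((gpl h)%:E <= cocycle_esssup P steps V h F)%E.
  move=> FK0; have bound (c : R) : (cocycle_esssup P steps V h F <= c%:E)%E -> gpl h <= c.
    move=> /ess_supP Fc.
    apply: (limit_le_cocycle_bound P_iid s0 z0 Vi V_local Vt (gpl_limit h) FK0).
    by apply: filterS Fc => w /bigmaxe_le Fw z /Fw; rewrite lee_fin.
  move: bound; case: (cocycle_esssup P steps V h F) => [c| |] bound.
  - by rewrite lee_fin; apply: bound.
  - exact: leey.
  (* An essential supremum [-oo] lies below every real number, so taking [c = gpl h - 1] is
     contradictory. *)
  - by have := bound (gpl h - 1) (leNye _); rewrite lerBrDr gerDl ler10.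
have [F FK0 Fle] := exists_corrector s0 P_iid Vi (gpl_limit h) steps_span.
have upper : (cocycle_esssup P steps V h F <= (gpl h)%:E)%E.
  apply/ess_supP; apply: filterS Fle => w Fw.
  by apply/bigmaxe_le => z zs; rewrite lee_fin; exact: Fw.
split; last first.
  by exists F => // F' F'K0; apply: le_trans upper (lower _ F'K0).
apply/eqP; rewrite eq_le; apply/andP; split.
  by apply: le_ereal_inf_tmp => _ [F' F'K0 <-]; exact: lower.
by apply: ge_ereal_inf; exists (cocycle_esssup P steps V h F) => //; exists F.
Qed.
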